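(* Let $n\ge2$, $k\ge1$, $\ell\in\{1,\dots,n-1\}$ with $\ell\le k$, $\alpha=(\alpha_1,\dots,\alpha_\ell)$ with $1\le\alpha_i\le n-1$, and $\mu,\nu\in\mathfrak P_{\le n-1,k}$. For any ${\bf j}=(j_1,\dots,j_\ell)\in(\mathbb Z/n\mathbb Z)^\ell$ and any sequence $S=(\nu=\mu^{(0)},\mu^{(1)},\dots,\mu^{(\ell)}=\mu)$ of partitions in $\mathfrak P_{\le n-1,k}$ put $$\mathcal N_i'(S,{\bf j})=\mathcal N^{(k+1),\ \varphi_{j_i}^*\widehat{\mu^{(i-1)}}}_{\widehat{(1^{\alpha_i})}\ \ \varphi_{j_i}^*\widehat{\mu^{(i)}}}.$$ Then $$\sum_S\mathcal N_1'(S,{\bf j})\,\mathcal N_2'(S,{\bf j})\cdots\mathcal N_\ell'(S,{\bf j})=\sum_{\lambda\in\mathfrak P_{\le n,\ell}}K_{\lambda^t\alpha}\,\mathcal N_{\hat\lambda\hat\mu}^{(k),\hat\nu},$$ where the left sum runs over all such sequences $S$. In particular, for all $1\le r\le n-1$, $j\in\mathbb Z/n\mathbb Z$ and $\hat\mu,\hat\nu\in P_k^+$, $$\mathcal N^{(k+1),\,\varphi_j^*\hat\nu}_{\widehat{(1^r)}\,\varphi_j^*\hat\mu}=\mathcal N^{(k),\,\hat\nu}_{\widehat{(1^r)}\,\hat\mu}.$$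
   Context: $\mathfrak P_{\le r,c}$: partitions with at most $r$ rows and at most $c$ columns. $P_k^+$: tuples $(m_0,\dots,m_{n-1})\in\mathbb Z_{\ge0}^n$ with sum $k$. For $\mu\in\mathfrak P_{\le n-1,k}$, $\hat\mu\in P_k^+$ is the tuple with $m_i=\mu_i-\mu_{i+1}$ for $1\le i\le n-1$ ($\mu_n=0$) and $m_0=k-\mu_1$. For $\lambda\in\mathfrak P_{\le n,\ell}$ one first deletes all columns of length $n$ and then takes the associated element $\hat\lambda\in P_k^+$. In a coefficient of level $k+1$, $\widehat{(1^{r})}$ denotes the corresponding weight in $P_{k+1}^+$. $\varphi_j^*:P_k^+\to P_{k+1}^+$ increases $m_j$ by one. $K_{\lambda\alpha}$ is the Kostka number: the number of semistandard tableaux of shape $\lambda$ and weight $\alpha$; $\lambda^t$ is the transposed partition. $\mathcal N^{(k),\hat\nu}_{\hat\lambda\hat\mu}$ are the level $k$ fusion coefficients of $\widehat{\mathfrak{sl}}(n)$, given by the Verlinde formula $\mathcal N_{\hat\lambda\hat\mu}^{(k),\hat\nu}=\sum_{\hat\sigma\in P_k^+}\mathcal S_{\hat\lambda\hat\sigma}\mathcal S_{\hat\mu\hat\sigma}\mathcal S_{\hat\nu^*\hat\sigma}/\mathcal S_{0\hat\sigma}$, where $\hat\nu^*$ is $\hat\nu$ with $m_i$ replaced by $m_{n-i}$ ($1\le i\le n-1$), $0$ stands for $(k,0,\dots,0)$, and $$\mathcal S_{\hat\lambda\hat\sigma}=\frac{e^{\iota\pi n(n-1)/4}}{\sqrt{n(k+n)^{n-1}}}\sum_{w\in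 S_n}(-1)^{\ell(w)}e^{-\frac{2\pi\iota}{k+n}(\sigma+\rho,w(\lambda+\rho))},\quad\iota=\sqrt{-1},$$ where $\lambda=\sum_{i=1}^n(\lambda_i-|\lambda|/n)\varepsilon_i$ for the partition belonging to $\hat\lambda$, similarly $\sigma$, $\rho=\sum_i(\frac{n+1}2-i)\varepsilon_i$, $(\varepsilon_i,\varepsilon_j)=\delta_{ij}$. *)

(* Defs.v *)
From HB Require Import structures.
From mathcomp Require Import all_boot all_order all_fingroup all_algebra.
From mathcomp Require Import reals trigo.
From mathcomp Require Export complex.
Set Implicit Arguments.
Unset Strict Implicit.
Unset Printing Implicit Defensive.
Import GRing.Theory Num.Theory.

Local Open Scope nat_scope.

(** ** Partitions in a box

  A partition with at most [r] rows and at most [c] columns is stored as its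
  non-increasing list of exactly [r] row lengths (padded with zeros), each at
  most [c].  As a [seq nat] its (i+1)-st row is [nth 0 la i]. *)

Record boxpart (r c : nat) := BoxPart {
  boxpart_rows : r.-tuple 'I_c.+1;
  _ : sorted geq (map val boxpart_rows)
}.

HB.instance Definition _ r c := [isSub for @boxpart_rows r c].
HB.instance Definition _ r c := [Finite of boxpart r c by <:].

Definition seq_of_boxpart r c (la : boxpart r c) : seq nat :=
  map val (boxpart_rows la).
Coercion seq_of_boxpart : boxpart >-> seq.

Definition conj_part (s : seq nat) : seq nat :=
  [seq count (fun x => j < x) s | j <- iota 0 (head 0 s)].

Definition del_full_columns (n : nat) (s : seq nat) : seq nat :=
  [seq x - nth 0 s n.-1 | x <- s].

(** ** Kostka numbers *)

(** The boxes (row, column) of the Young diagram of [sh], numbered from 0. *)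
Definition cell (sh : seq nat) : finType :=
  {x : 'I_(size sh) * 'I_(head 0 sh) | x.2 < nth 0 sh x.1}.

Definition semistandard (sh : seq nat) (m : nat)
    (T : {ffun cell sh -> 'I_m}) : bool :=
  [forall x : cell sh, forall y : cell sh,
     (((val x).1 == (val y).1) && ((val x).2 <= (val y).2) ==> (T x <= T y))
  && (((val x).2 == (val y).2) && ((val x).1 < (val y).1) ==> (T x < T y))].

Definition has_content (sh : seq nat) (m : nat)
    (T : {ffun cell sh -> 'I_m}) (al : 'I_m -> nat) : bool :=
  [forall i : 'I_m, #|[set x | T x == i]| == al i].

Definition kostka (sh : seq nat) (m : nat) (al : 'I_m -> nat) : nat :=
  #|[set T : {ffun cell sh -> 'I_m} | semistandard T && has_content T al]|.

(** ** Affine weights *)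

(** The tuple [(m_0, ..., m_(n-1))] of Dynkin labels; the index type ['I_n]
  also plays the role of Z/nZ. *)
Definition weight (n : nat) : Type := {ffun 'I_n -> nat}.

(** The dominant weights of level [k]: labels summing to [k]. *)
Record Pplus (n k : nat) := MkPplus {
  Pplus_labels : {ffun 'I_n -> 'I_k.+1};
  _ : \sum_i (Pplus_labels i : nat) == k
}.

HB.instance Definition _ n k := [isSub for @Pplus_labels n k].
HB.instance Definition _ n k := [Finite of Pplus n k by <:].

Definition weight_of_Pplus n k (m : Pplus n k) : weight n :=
  [ffun i => val (Pplus_labels m i)].
Coercion weight_of_Pplus : Pplus >-> weight.

(** The level-[k] weight of the partition [s]; the truncated subtractions are
  harmless for a partition with at most [n.-1] rows and [k] columns, see
  [hat_level]. *)
Definition hat (n k : nat) (s : seq nat) : weight n :=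
  [ffun i : 'I_n =>
     if val i == 0 then k - nth 0 s 0 else nth 0 s i.-1 - nth 0 s i].

Definition vacuum (n k : nat) : weight n :=
  [ffun i : 'I_n => if val i == 0 then k else 0].

(** [ordS (rev_ord i)] is [(n - i) %% n]. *)
Definition dual_weight n (m : weight n) : weight n :=
  [ffun i => m (ordS (rev_ord i))].

Definition phi n (j : 'I_n) (m : weight n) : weight n :=
  [ffun i => m i + (i == j)].

(** The (i+1)-st row of the partition with at most [n.-1] rows whose
  successive row differences are [m_1, ..., m_(n-1)]. *)
Definition row_of_weight n (m : weight n) (i : 'I_n) : nat :=
  \sum_(j < n | i < j) m j.

Lemma level_Pplus n k (m : weight n) :
  \sum_i m i = k -> exists p : Pplus n k, weight_of_Pplus p = m.
Proof.
move=> mk; have lem i : m i < k.+1 by rewrite ltnS -mk (bigD1 i) //= leq_addr.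
have pP : \sum_i ([ffun i => Ordinal (lem i)] i : nat) == k.
  by rewrite -[X in _ == X]mk; apply/eqP/eq_bigr => i _; rewrite ffunE.
by exists (MkPplus pP); apply/ffunP => i; rewrite !ffunE.
Qed.

Lemma phi_level n (j : 'I_n) (m : weight n) :
  \sum_i phi j m i = (\sum_i m i).+1.
Proof.
under eq_bigr do rewrite ffunE.
rewrite big_split /= -[RHS]addn1; congr addn.
by rewrite (bigD1 j) //= eqxx big1 // => i /negPf->.
Qed.

Lemma hat_level n k (s : seq nat) : 0 < n -> sorted geq s ->
  nth 0 s 0 <= k -> nth 0 s n.-1 = 0 -> \sum_i hat n k s i = k.
Proof.
case: n => // n _ ss s0 sn.
rewrite big_ord_recl ffunE /=; under eq_bigr do rewrite ffunE /=.
have anti i : nth 0 s i.+1 <= nth 0 s i.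
  have [lt|ge] := ltnP i.+1 (size s); last by rewrite nth_default.
  by move/(sortedP 0): ss => /(_ _ lt).
suff E p : \sum_(i < p) (nth 0 s i - nth 0 s i.+1) + nth 0 s p = nth 0 s 0.
  by have := E n; rewrite [nth 0 s n]sn addn0 => ->; rewrite subnK.
elim: p => [|p IH]; first by rewrite big_ord0.
by rewrite big_ord_recr /= -addnA subnK.
Qed.

Local Open Scope ring_scope.

(** ** Modular S-matrix and fusion coefficients *)

Section Fusion.
Variable R : realType.

(** The exponential of [iota * t]. *)
Definition expi (t : R) : R[i] := (cos t +i* sin t)%C.

(** The [i]-th epsilon-coordinate of [la + rho], with [i] counted from 0. *)
Definition shifted_coord n (m : weight n) (i : 'I_n) : R :=
  (row_of_weight m i)%:R - (\sum_(j < n) row_of_weight m j)%:R / n%:R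
  + ((n.+1)%:R / 2 - (i.+1)%:R).

(** The pairing [(si + rho, w (la + rho))], where [w] sends the [i]-th basis
  vector to the [w i]-th one. *)
Definition shifted_pairing n (w : 'S_n) (la si : weight n) : R :=
  \sum_(i < n) shifted_coord si (w i) * shifted_coord la i.

Definition Smat n (k : nat) (la si : weight n) : R[i] :=
  expi (pi * n%:R * (n%:R - 1) / 4)
    / (Num.sqrt (n%:R * (k + n)%:R ^+ n.-1))%:C%C
  * \sum_(w : 'S_n)
      (-1) ^+ w * expi (- (2 * pi / (k + n)%:R) * shifted_pairing w la si).

(** [fusion k la mu nu] has upper index [nu] and lower indices [la], [mu]. *)
Definition fusion n (k : nat) (la mu nu : weight n) : R[i] :=
  \sum_(si : Pplus n k)
    Smat k la si * Smat k mu si * Smat k (dual_weight nu) si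
      / Smat k (vacuum n k) si.

End Fusion.

(* Main.v *)
Require Import Defs.
From HB Require Import structures.
From mathcomp Require Import all_boot all_order all_fingroup all_algebra.
From mathcomp Require Import reals trigo.
From mathcomp Require Import zify ring lra.
Set Implicit Arguments.
Unset Strict Implicit.
Unset Printing Implicit Defensive.
Import Order.TTheory GRing.Theory Num.Theory.
Local Open Scope ring_scope.

(** Write [N = k + n] and [wave t = exp (- 2 pi i t / N)].  Up to a scalar that
  does not depend on the two weights, the entry of the S-matrix at [la] and [si]
  is the alternating sum over permutations [w] of
  [wave (si + rho, w (la + rho))], here called [alternant]; the quotient of two
  entries in one column is a Schur polynomial evaluated at the [n] points
  [wave (si + rho)_i], which are distinct, have product 1 and a common [N]-th
  power.

  For a fundamental weight the Schur polynomial is the elementary symmetric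
  polynomial [e_r].  Multiplying an alternant by [e_r] adds a vertical strip to
  the weight in all possible ways, and the alternant vanishes as soon as the
  shifted weight falls on a wall of the alcove; so each column of the S-matrix is
  an eigenvector of the matrix [nstep r] that counts vertical strips of size [r]
  (taken cyclically) between two weights of level [k], with eigenvalue [e_r]
  ([elsym_alternant_coord]).  Once the S-matrix is known to be unitary
  ([alternant_unitary]), the Verlinde sum for the fundamental weight collapses to
  [nstep r] ([fusion_column]).  Whether a strip leads from [mu] to [nu] depends
  only on the difference of their labels, which is unchanged when the same
  fundamental weight is added to both: this is the equality of coefficients of
  levels [k + 1] and [k].

  Unitarity splits into two parts.  Distinct columns are orthogonal because the
  matrices [nstep r] and [nstep (n - r)] are adjoint and the eigenvalues [e_r]
  separate the columns ([alternant_orthogonal]).  The norm comes from the sum of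
  the squared modulus of the alternant over the whole torus [(Z/N)^n], which is
  computed by orthogonality of characters ([torus_norm_total]).  By translation it
  suffices to sum over the points with an entry 0; those with distinct entries
  are, up to order, the weights of level [k], and at the others the alternant
  vanishes ([alternant_norm]).

  For the general identity, the left side is the sum over paths that expresses
  the product of the matrices [nstep (al i)], hence by unitarity it is the
  Verlinde sum in which the Schur polynomial is replaced by the product of the
  [e_(al i)] ([prod_elsym_paths]).  That product is expanded into Schur
  polynomials by the same strip rule starting from the empty partition.  The
  coefficient of [la] counts the ways of building [la] by vertical strips of
  sizes [al 0], [al 1], ..., and recording the step at which a box appears turns
  them into semistandard tableaux of the transposed shape
  ([prod_elsym_kostka]). *)

(** * The exponential on the unit circle *)

Section Expi.
Variable R : realType.
Implicit Types s t : R.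

Lemma expi0 : expi (0 : R) = 1.
Proof. by rewrite /expi cos0 sin0. Qed.

Lemma expiD s t : expi (s + t) = expi s * expi t.
Proof.
by apply/eqP; rewrite eq_complex /= cosD sinD eqxx [X in _ == X]addrC eqxx.
Qed.

Lemma conj_expi t : ((expi t)^*)%C = expi (- t).
Proof. by rewrite /expi cosN sinN. Qed.

Lemma expiNK t : expi t * expi (- t) = 1.
Proof. by rewrite -expiD subrr expi0. Qed.

Lemma expi_mulrn t n : expi (t *+ n) = expi t ^+ n.
Proof. by elim: n => [|n IH]; rewrite ?mulr0n ?expi0 // mulrS exprS expiD IH. Qed.

Lemma expi_pi : expi (pi : R) = -1.
Proof. by rewrite /expi cospi sinpi; apply/eqP; rewrite eq_complex /= oppr0 !eqxx. Qed.

Lemma expi_2pi (z : int) : expi (2 * pi * z%:~R : R) = 1.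
Proof.
have e n : expi (2 * pi * n%:R : R) = 1.
  have -> : 2 * pi * n%:R = (pi *+ 2 : R) *+ n by rewrite mulr_natr mulrC mulr_natr.
  by rewrite expi_mulrn [expi (_ *+ 2)]expi_mulrn expi_pi sqrrN !expr1n.
case: z => n; first exact: e.
by rewrite NegzE mulrNz mulrN -[RHS](expiNK (2 * pi * n.+1%:R)) e mul1r.
Qed.

(** Reduce [t] modulo [2 * pi] to [s] with [0 <= s < 2 * pi]: as [cos s = 1], the
  double angle formula gives [sin (s / 2) = 0], and [sin] has no zero strictly
  between 0 and [pi]. *)
Lemma expi_eq1 t : expi t = 1 -> exists z : int, t = 2 * pi * z%:~R.
Proof.
move=> t1; have pi0 := pi_gt0 R; have pi20 : (0 : R) < 2 * pi by lra.
pose z := Num.floor (t / (2 * pi)); exists z.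
pose s := t - 2 * pi * z%:~R.
have s1 : expi s = 1 by rewrite /s expiD t1 mul1r -mulrN -mulrNz expi_2pi.
have [s0 sp] : 0 <= s /\ s < 2 * pi.
  have := floor_le_tmp (t / (2 * pi)); have := floorD1_gt (t / (2 * pi)).
  rewrite -/z ltr_pdivrMr // ler_pdivlMr // rmorphD /= => h1 h2.
  by rewrite /s; split; [lra|rewrite mulrDl mul1r in h1; lra].
have c1 : cos s = 1 by case: s1.
have : sin (s / 2) = 0.
  apply/eqP; rewrite -sqrf_eq0; apply/eqP.
  have h := cos_mulr2n (s / 2).
  have e : s / 2 *+ 2 = s by rewrite -mulr_natr divfK // pnatr_eq0.
  by rewrite e c1 in h; rewrite sin2cos2; lra.
have [s_eq0 _|sN0 /eqP] := eqVneq s 0.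
  by apply/eqP; rewrite -subr_eq0 -/s s_eq0.
have sgt0 : 0 < s by rewrite lt_def sN0.
have : 0 < sin (s / 2) by apply: sin_gt0_pi; apply/andP; split; lra.
by move/gt_eqF ->.
Qed.

End Expi.

(** * Alternating exponential sums *)

Section Alternant.
Variables (R : realType) (N : nat).
Implicit Types (s t : R).

Definition wave t : R[i] := expi (- (2 * pi / N%:R) * t).

Lemma wave0 : wave 0 = 1. Proof. by rewrite /wave mulr0 expi0. Qed.

Lemma waveD s t : wave (s + t) = wave s * wave t.
Proof. by rewrite /wave mulrDr expiD. Qed.

Lemma conj_wave t : ((wave t)^*)%C = wave (- t).
Proof. by rewrite /wave conj_expi mulrN. Qed.

Lemma waveNK t : wave t * wave (- t) = 1.
Proof. by rewrite -waveD subrr wave0. Qed.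

Lemma wave_sum (I : Type) (r : seq I) (P : pred I) (F : I -> R) :
  wave (\sum_(i <- r | P i) F i) = \prod_(i <- r | P i) wave (F i).
Proof. by apply: (big_morph _ waveD wave0). Qed.

Lemma wave_exp t n : wave t ^+ n = wave (t * n%:R).
Proof.
by elim: n => [|n IH]; rewrite ?mulr0 ?wave0 // exprS IH -waveD -natr1 mulrDr mulr1 addrC.
Qed.

Hypothesis N_gt0 : (0 < N)%N.

Lemma wave_period (z : int) : wave (N%:R * z%:~R) = 1.
Proof.
rewrite /wave -[RHS](expi_2pi R (- z)); congr expi.
by rewrite rmorphN /=; field; rewrite pnatr_eq0 -lt0n.
Qed.

Lemma wave_eq1 t : wave t = 1 -> exists z : int, t = N%:R * z%:~R.
Proof.
move=> /expi_eq1 [z e]; exists (- z); rewrite rmorphN /= .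
have p0 : 2 * pi != 0 :> R by rewrite mulf_neq0 ?pnatr_eq0 // gt_eqF // pi_gt0.
have N0 : N%:R != 0 :> R by rewrite pnatr_eq0 -lt0n.
apply: (mulfI p0); apply: (mulIf (x := - N%:R^-1)); first by rewrite oppr_eq0 invr_eq0.
by transitivity (2 * pi * z%:~R : R); [rewrite -e; ring | field].
Qed.

(** Orthogonality of the characters of [Z/N]. *)
Lemma wave_geometric (z : int) : (0 < `|z| < N)%N ->
  \sum_(t < N) wave (z%:~R * t%:R) = 0.
Proof.
move=> /andP[z0 zN].
have w1 : wave (z%:~R) != 1.
  apply/eqP => /wave_eq1[y]; rewrite -[N%:R]/(N%:Z%:~R) -rmorphM /= => /eqP.
  rewrite eqr_int => /eqP e; move: z0 zN; rewrite e abszM absz_nat.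
  by case: (absz y) => [|m]; rewrite ?muln0 // => _; rewrite ltnNge leq_pmulr.
apply: (mulfI (x := wave z%:~R - 1)); first by rewrite subr_eq0.
under eq_bigr do rewrite -wave_exp.
by rewrite -subrX1 wave_exp mulrC wave_period subrr mulr0.
Qed.

Variable n : nat.
Implicit Types (c u v : 'I_n -> R) (I : {set 'I_n}) (w : 'S_n).

Definition pairing c u : R := \sum_i c i * u i.

(** The alternating exponential sum; up to a scalar, the entries of the modular
  S-matrix are its values at shifted weights. *)
Definition alternant c u : R[i] :=
  \sum_(w : 'S_n) (-1) ^+ w * wave (pairing (c \o w) u).

Lemma eq_alternant c c' u u' : c =1 c' -> u =1 u' -> alternant c u = alternant c' u'.
Proof.
move=> ec eu; apply: eq_bigr => w _; congr (_ * wave _).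
by apply: eq_bigr => i _; rewrite /= ec eu.
Qed.

Lemma pairing_perm c u w : pairing (c \o w) u = pairing c (u \o (w^-1)%g).
Proof.
rewrite /pairing (reindex_inj (@perm_inj _ (w^-1)%g)) /=.
by apply: eq_bigr => i _; rewrite permKV.
Qed.

Lemma pairingC c u : pairing c u = pairing u c.
Proof. by apply: eq_bigr => i _; rewrite mulrC. Qed.

Lemma pairingDr c u v : pairing c (fun i => u i + v i) = pairing c u + pairing c v.
Proof. by rewrite -big_split; apply: eq_bigr => i _; rewrite mulrDr. Qed.

Lemma alternantC c u : alternant c u = alternant u c.
Proof.
rewrite /alternant (reindex_inj invg_inj) /=; apply: eq_bigr => w _.
by rewrite odd_permV pairing_perm invgK pairingC.
Qed.

Lemma alternant_perm c u w : alternant c (u \o w) = (-1) ^+ w * alternant c u.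
Proof.
rewrite /alternant (reindex_inj (mulgI w)) big_distrr /=; apply: eq_bigr => w' _.
rewrite odd_permM signr_addb -mulrA; congr (_ * (_ * wave _)).
rewrite !pairing_perm; apply: eq_bigr => i _.
by rewrite /= invMg permM permKV.
Qed.

Lemma conj_alternant c u : ((alternant c u)^*)%C = alternant c (fun i => - u i).
Proof.
rewrite /alternant rmorph_sum; apply: eq_bigr => w _.
rewrite rmorphM rmorph_sign; congr (_ * _); rewrite [LHS]conj_wave; congr wave.
by rewrite /pairing -sumrN; apply: eq_bigr => i _; rewrite mulrN.
Qed.

Lemma alternant_translate c u t : \sum_i c i = 0 ->
  alternant c (fun i => u i + t) = alternant c u.
Proof.
move=> c0; apply: eq_bigr => w _; congr (_ * wave _).
rewrite pairingDr -[RHS]addr0; congr (_ + _).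
rewrite /pairing -mulr_suml.
have -> : \sum_i (c \o w) i = \sum_i c i by rewrite [RHS](reindex_inj (@perm_inj _ w)).
by rewrite c0 mul0r.
Qed.

(** The entries of [c] are integers up to a common real [ka]; as [wave] has period
  [N], only [ka] feels the translation of [u] by [N * z], and it contributes the
  same phase to every term. *)
Lemma alternant_lattice (ka : R) (y z : 'I_n -> int) c u :
    (forall i, c i = ka + (y i)%:~R) ->
  alternant c (fun i => u i + N%:R * (z i)%:~R)
    = wave (ka * (N%:R * (\sum_i z i)%:~R)) * alternant c u.
Proof.
move=> ec; rewrite /alternant mulr_sumr; apply: eq_bigr => w _.
rewrite mulrCA -waveD; congr (_ * _); rewrite pairingDr addrC !waveD; congr (_ * _).
have -> : pairing (c \o w) (fun i => N%:R * (z i)%:~R) =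
    ka * (N%:R * (\sum_i z i)%:~R) + N%:R * (\sum_i y (w i) * z i)%:~R.
  rewrite !rmorph_sum /= !mulr_sumr -big_split; apply: eq_bigr => i _ /=.
  by rewrite ec rmorphM /=; ring.
by rewrite waveD wave_period mulr1.
Qed.

Lemma alternant_eq0 c u i j : i != j -> u i = u j -> alternant c u = 0.
Proof.
move=> ij uij; have /= := alternant_perm c u (tperm i j).
rewrite odd_tperm ij expr1 mulN1r (eq_alternant (c' := c) (u' := u)) // => [/eqP|m /=].
  by rewrite -addr_eq0 -mulr2n mulrn_eq0 => /eqP.
by case: tpermP => [->|->|].
Qed.

(** The affine wall: exchanging the entries [i] and [j] of [u] and translating them
  by [-N] and [N] gives [u] back, while the exchange changes the sign and the
  translation, whose entries sum to 0, changes nothing. *)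
Lemma alternant_affine_eq0 (ka : R) (y : 'I_n -> int) c u i j :
    (forall m, c m = ka + (y m)%:~R) -> i != j -> u i = u j + N%:R ->
  alternant c u = 0.
Proof.
move=> ec ij uij.
pose z m : int := (m == j)%:Z - (m == i)%:Z.
have := alternant_lattice z u ec.
have one l : \sum_m (m == l)%:Z = 1 :> int.
  by rewrite (bigD1 l) //= eqxx big1 ?addr0 // => m /negPf ->.
have -> : \sum_m z m = 0 by rewrite /z sumrB !one subrr.
rewrite !mulr0 wave0 mul1r => e.
have /= := alternant_perm c u (tperm i j).
rewrite odd_tperm ij expr1 mulN1r.
rewrite (eq_alternant (c' := c) (u' := fun m => u m + N%:R * (z m)%:~R)) //.
  by rewrite e => /eqP; rewrite -addr_eq0 -mulr2n mulrn_eq0 => /eqP.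
move=> m /=; rewrite /z; case: tpermP => [->|->|/eqP/negPf-> /eqP/negPf->].
- by rewrite eqxx (negPf ij) uij sub0r mulrN1 addrK.
- by rewrite eqxx eq_sym (negPf ij) subr0 mulr1 uij.
- by rewrite subr0 mulr0 addr0.
Qed.

(** The elementary symmetric polynomials of the points [wave (c i)]. *)
Definition elsym r c : R[i] :=
  \sum_(I : {set 'I_n} | #|I| == r) wave (\sum_(i in I) c i).

Definition indic I : 'I_n -> R := fun i => (i \in I)%:R.

(** In the term of the permutation [w] the symmetric polynomial may be rewritten
  as the sum over the images of the sets under [w], whose waves then combine with
  the exponent. *)
Lemma elsym_alternant r c u :
  elsym r c * alternant c u
    = \sum_(I : {set 'I_n} | #|I| == r) alternant c (fun i => u i + indic I i).
Proof.
rewrite /alternant exchange_big mulr_sumr /=; apply: eq_bigr => w _.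
rewrite -mulr_sumr mulrCA; congr (_ * _).
under [RHS]eq_bigr do rewrite pairingDr waveD.
rewrite -mulr_sumr mulrC; congr (_ * _); rewrite /elsym.
rewrite (reindex_inj (imset_inj (@perm_inj _ w))) /=.
apply: eq_big => [I|I _]; first by rewrite card_imset //; apply: perm_inj.
congr wave; rewrite big_imset /= => [|i j _ _]; last exact: perm_inj.
rewrite big_mkcond; apply: eq_bigr => i _ /=.
by rewrite /indic; case: (i \in I); rewrite ?mulr1 ?mulr0.
Qed.

End Alternant.

(** * Weights as points of an alcove *)

Lemma nth_anti (s : seq nat) (i j : nat) :
  sorted geq s -> (i <= j)%N -> (nth 0 s j <= nth 0 s i)%N.
Proof.
move=> ss ij; have [lt|ge] := ltnP j (size s); last by rewrite nth_default.
apply: (sorted_leq_nth (leT := geq)) => //; rewrite ?inE ?(leq_ltn_trans ij) //.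
- by move=> a b d ab bd; apply: leq_trans bd ab.
- exact: leqnn.
Qed.

Section Coordinates.
Variables (R : realType) (n : nat).
Hypothesis n_gt1 : (1 < n)%N.
Implicit Types (m : weight n) (i j : 'I_n).

Let n_gt0 : (0 < n)%N. Proof. exact: ltnW. Qed.

Local Notation coord := (shifted_coord R).

Lemma val_ord_pred i : val i != 0%N -> val (ord_pred i) = (val i).-1.
Proof.
case: i => [[|i] lt_in] //= _.
by rewrite modnDr modn_small // ltnW.
Qed.

Lemma val_ord_pred0 i : val i = 0%N -> val (ord_pred i) = n.-1.
Proof. by move=> /= ->; rewrite add0n modn_small // prednK. Qed.

Lemma ord_pred_neq i : ord_pred i != i.
Proof.
apply/eqP => /(congr1 val); have [i0|i0] := eqVneq (val i) 0%N.
  by rewrite val_ord_pred0 // i0; lia.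
by rewrite val_ord_pred //; move: i0 => /=; lia.
Qed.

Lemma coordB m i j :
  coord m i - coord m j
    = (row_of_weight m i)%:R - (row_of_weight m j)%:R + (j%:R - i%:R).
Proof. by rewrite /shifted_coord -!natr1; ring. Qed.

Lemma sum_coord m : \sum_i coord m i = 0.
Proof.
have n0 : n%:R != 0 :> R by rewrite pnatr_eq0 -lt0n.
have tri p : \sum_(i < p) (i.+1)%:R = p%:R * (p.+1)%:R / 2 :> R.
  elim: p => [|p IH]; first by rewrite big_ord0 !mul0r.
  by rewrite big_ord_recr /= IH -!natr1; field.
rewrite /shifted_coord !big_split /= !sumrN tri !sumr_const card_ord natr_sum.
by rewrite -[_ / n%:R *+ _]mulr_natr -[_ / 2 *+ _]mulr_natr -natr1; field.
Qed.

Lemma row_of_weight_pred m i : val i != 0%N ->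
  row_of_weight m (ord_pred i) = (m i + row_of_weight m i)%N.
Proof.
move=> i0; have := val_ord_pred i0; rewrite /row_of_weight => /= ->.
rewrite (bigD1 i) /=; last by move: i0 => /=; lia.
congr addn; apply: eq_bigl => j; rewrite -val_eqE /=.
by move: i0 => /=; lia.
Qed.

Lemma row_of_weight_last m i : val i = n.-1 -> row_of_weight m i = 0%N.
Proof.
by move=> /= i0; rewrite /row_of_weight big_pred0 // => j; have := ltn_ord j; lia.
Qed.

Lemma row_of_weight0 m i : val i = 0%N -> (m i + row_of_weight m i)%N = (\sum_j m j)%N.
Proof.
move=> i0; rewrite [RHS](bigD1 i) //=; congr addn; apply: eq_bigl => j.
by rewrite -val_eqE /=; move: i0 => /= ->; rewrite lt0n.
Qed.

Lemma row_of_weight_anti m i j : (i <= j)%N -> (row_of_weight m j <= row_of_weight m i)%N.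
Proof.
move=> ij; rewrite /row_of_weight [leqRHS]big_mkcond [leqLHS]big_mkcond /=.
by apply: leq_sum => l _; case: ltnP => // jl; rewrite (leq_ltn_trans ij jl).
Qed.

Lemma row_of_weight_le m i : (row_of_weight m i <= \sum_j m j)%N.
Proof.
by rewrite /row_of_weight big_mkcond; apply: leq_sum => l _; case: ifP.
Qed.

(** The labels are recovered as the gaps between cyclically consecutive
  coordinates, the last gap being closed up by the period [k + n]. *)
Lemma coord_gap k m i : (\sum_j m j = k)%N ->
  coord m (ord_pred i) - coord m i
    = (m i).+1%:R - (if val i == 0%N then (k + n)%:R else 0).
Proof.
move=> mk; rewrite coordB; case: eqP => [i0|/eqP i0].
  rewrite -mk -(row_of_weight0 m i0) (row_of_weight_last m (val_ord_pred0 i0)).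
  have -> : (ord_pred i : nat) = n.-1 by exact: val_ord_pred0.
  have -> : (i : nat) = 0%N by [].
  have nE : n%:R = n.-1%:R + 1 :> R by rewrite natr1 prednK.
  by rewrite !natrD nE -natr1; ring.
rewrite row_of_weight_pred // natrD.
have -> : (ord_pred i : nat) = i.-1 by exact: val_ord_pred.
have iE : i%:R = i.-1%:R + 1 :> R by rewrite natr1 prednK // lt0n.
by rewrite iE -natr1; ring.
Qed.

(** Shifted weights of level [k] lie in the interior of the fundamental alcove. *)
Lemma coord_window k m i j : (\sum_l m l = k)%N -> (i < j)%N ->
  0 < coord m i - coord m j < (k + n)%:R.
Proof.
move=> mk ij; rewrite coordB.
have := row_of_weight_anti m (ltnW ij); have := row_of_weight_le m i.
rewrite mk => h1 h2; rewrite -!natrB ?(ltnW ij) // -natrD ltr0n ltr_nat.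
by have := ltn_ord j; lia.
Qed.

Lemma coord_int_diff m :
  exists ka : R, exists y : 'I_n -> int, forall i, coord m i = ka + (y i)%:~R.
Proof.
exists (- (\sum_(j < n) row_of_weight m j)%:R / n%:R + (n.+1)%:R / 2).
exists (fun i => (row_of_weight m i)%:Z - (i.+1)%:Z) => i.
by rewrite /shifted_coord rmorphB /=; ring.
Qed.

Lemma eq_up_to_translation (u v : 'I_n -> R) :
    (forall i, val i != 0%N -> u (ord_pred i) - u i = v (ord_pred i) - v i) ->
  exists t, forall i, u i = v i + t.
Proof.
move=> gap; pose o := Ordinal n_gt0; exists (u o - v o).
suff E p (lt_p : (p < n)%N) : u (Ordinal lt_p) = v (Ordinal lt_p) + (u o - v o).
  by case=> p lt_p; exact: E.
elim: p lt_p => [|p IH] lt_p.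
  by rewrite (_ : Ordinal lt_p = o); [rewrite addrC subrK|apply: val_inj].
have /= := gap (Ordinal lt_p) isT.
have -> : ord_pred (Ordinal lt_p) = Ordinal (ltnW lt_p).
  by apply: val_inj; rewrite val_ord_pred.
by rewrite IH; lra.
Qed.

Lemma eq_of_gaps (u v : 'I_n -> R) : \sum_i u i = \sum_i v i ->
    (forall i, val i != 0%N -> u (ord_pred i) - u i = v (ord_pred i) - v i) ->
  u =1 v.
Proof.
move=> suv /eq_up_to_translation [t uv] i.
have : \sum_i u i = \sum_i (v i + t) by apply: eq_bigr => j _; exact: uv.
rewrite suv big_split /= sumr_const card_ord => /eqP.
rewrite -[X in X == _]addr0 (inj_eq (addrI _)) eq_sym mulrn_eq0 eqn0Ngt n_gt0 /=.
move=> /eqP t0.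
by rewrite uv t0 addr0.
Qed.

(** The labels of positive index only see the differences of consecutive rows, so
  columns of length [n] disappear. *)
Lemma row_of_hat k (s : seq nat) i : sorted geq s ->
  row_of_weight (hat n k s) i = (nth 0 s i - nth 0 s n.-1)%N.
Proof.
move=> ss.
have anti p : (nth 0 s p.+1 <= nth 0 s p)%N by exact: nth_anti.
have E p j : (val j + p)%N = n.-1 ->
    row_of_weight (hat n k s) j = (nth 0 s j - nth 0 s n.-1)%N
      /\ (nth 0 s n.-1 <= nth 0 s j)%N.
  elim: p j => [|p IH] j jp.
    by rewrite addn0 in jp; rewrite row_of_weight_last //= -jp subnn.
  have lt_j : (j.+1 < n)%N by move: jp => /=; lia.
  have [|r le] := IH (Ordinal lt_j); first by rewrite /= addSn -addnS.
  have pj : ord_pred (Ordinal lt_j) = j by apply: val_inj; rewrite val_ord_pred.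
  rewrite -{1}pj row_of_weight_pred // r ffunE /=.
  by have := anti j; move: le => /=; lia.
by have [] := E (n.-1 - i)%N i; first by (have := ltn_ord i; rewrite /=; lia).
Qed.

End Coordinates.

(** * The affine Pieri rule *)

Section Steps.
Variables (n : nat).
Hypothesis n_gt1 : (1 < n)%N.
Implicit Types (m : weight n) (I : {set 'I_n}) (i j : 'I_n).

Lemma sum_Pplus k (p : Pplus n k) : (\sum_i (p : weight n) i = k)%N.
Proof.
by case: p => p pk; rewrite -[RHS](eqP pk); apply: eq_bigr => i _; rewrite ffunE.
Qed.

Lemma weight_of_Pplus_inj k : injective (@weight_of_Pplus n k).
Proof.
move=> p q /ffunP e; apply: val_inj; apply/ffunP => i; apply: val_inj.
by have := e i; rewrite !ffunE.
Qed.

(** A box is added to each row in [I], the rows being indexed by [Z/n]: row [j]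
  enters the label [j] negatively and the label [j + 1] positively.  The equation
  is arranged so that no subtraction occurs. *)
Definition step I m m' : bool :=
  [forall j, (m' j + (j \in I) == m j + (ord_pred j \in I))%N].

Definition nstep r m m' : nat := #|[set I : {set 'I_n} | (#|I| == r) && step I m m']|.

(** The invariance behind the comparison of levels [k] and [k + 1]: only the
  difference of the two weights matters. *)
Lemma step_phi I j m m' : step I (phi j m) (phi j m') = step I m m'.
Proof.
apply: eq_forallb => i.
by rewrite !ffunE -!addnA ![((i == j) + _)%N]addnC !addnA eqn_add2r.
Qed.

Lemma nstep_phi r j m m' : nstep r (phi j m) (phi j m') = nstep r m m'.
Proof. by apply: eq_card => I; rewrite !inE step_phi. Qed.

Lemma step_setC I m m' : step (~: I) m' m = step I m m'.
Proof.
apply: eq_forallb => j; rewrite !inE.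
by case: (j \in I); case: (_ \in I); rewrite /= ?addn0 ?addn1 ?eqSS eq_sym.
Qed.

(** Adding a set of boxes and then its complement adds a whole column, which is
  invisible to the labels: the steps of sizes [r] and [n - r] are adjoint. *)
Lemma nstep_adjoint r m m' : (r <= n)%N -> nstep (n - r)%N m' m = nstep r m m'.
Proof.
move=> rn; rewrite /nstep -(card_preimset _ (inv_inj (@setCK _))).
apply: eq_card => I; rewrite !inE step_setC; congr andb.
have := cardsC I; rewrite cardsE card_ord; have := max_card I; rewrite card_ord; lia.
Qed.

Lemma step_inj I m m' m'' : step I m m' -> step I m m'' -> m' = m''.
Proof.
move=> /forallP h /forallP h'; apply/ffunP => j; apply/eqP.
by rewrite -(eqn_add2r (j \in I)) (eqP (h j)) (eqP (h' j)).
Qed.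

Lemma step_target k I m : (\sum_i m i = k)%N ->
    (forall j, (j \in I <= m j + (ord_pred j \in I))%N) ->
  exists p : Pplus n k, step I m p.
Proof.
move=> mk le; pose m' : weight n := [ffun j => (m j + (ord_pred j \in I) - (j \in I))%N].
have st : step I m m' by apply/forallP => j; rewrite ffunE subnK.
have [|p e] := @level_Pplus n k m'; last by exists p; rewrite e.
apply: (@addIn (\sum_j (j \in I))%N); rewrite -{1}big_split /=.
under eq_bigr => j _ do rewrite (eqP (forallP st j)).
rewrite big_split /= mk; congr addn.
by rewrite [RHS](reindex_inj (@ord_pred_inj n)).
Qed.

Section Pieri.
Variables (R : realType) (k : nat).
Local Notation N := (k + n)%N.
Local Notation coord := (shifted_coord R).

Lemma coord_step I m m' : step I m m' ->
  exists t, forall i, coord m' i = coord m i + indic R I i + t.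
Proof.
move=> /forallP st; apply: (eq_up_to_translation n_gt1) => j j0.
rewrite (coord_gap R n_gt1 _ (erefl (\sum_l m' l)%N)) (negPf j0) subr0.
have := coord_gap R n_gt1 j (erefl (\sum_l m l)%N); rewrite (negPf j0) subr0.
have /(congr1 (fun x => x%:R : R)) := eqP (st j); rewrite !natrD -!natr1 /indic.
lra.
Qed.

(** If the set [I] leads out of the alcove, some label would become -1, which
  means that a gap of the shifted weight closes: the shifted weight lies on a
  wall and the alternant vanishes. *)
Lemma alternant_step I m c : (\sum_i m i = k)%N -> \sum_i c i = 0 ->
    (exists ka : R, exists y : 'I_n -> int, forall i, c i = ka + (y i)%:~R) ->
  alternant N c (fun i => coord m i + indic R I i)
    = \sum_(p : Pplus n k) (step I m p)%:R * alternant N c (coord p).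
Proof.
move=> mk c0 [ka [y ec]].
have [/forallP le|] := boolP [forall j, (j \in I <= m j + (ord_pred j \in I))%N].
  have [p st] := step_target mk le; rewrite (bigD1 p) //= st mul1r big1 ?addr0 => [|q qp].
    have [t e] := coord_step st.
    by rewrite -(alternant_translate N _ t c0); apply: eq_alternant => i //; rewrite e.
  case: (boolP (step I m q)) => [|_]; last by rewrite mul0r.
  move=> /(step_inj st)/weight_of_Pplus_inj/esym/eqP.
  by rewrite (negPf qp).
rewrite negb_forall => /existsP[j gt].
rewrite big1 => [|p _]; last first.
  case: (boolP (step I m p)) => [/forallP/(_ j)/eqP e|]; last by rewrite mul0r.
  by move: gt; rewrite -e leq_addl.
have [mj [jI pjI]] : [/\ m j = 0%N, j \in I & ord_pred j \notin I].
  move: gt; case: (j \in I) => //=; case: (ord_pred j \in I); rewrite /= ?addn1 ?addn0 //.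
  by rewrite -ltnNge ltnS leqn0 => /eqP.
have := coord_gap R n_gt1 j mk; rewrite mj => gap.
have N0 : (0 < N)%N by lia.
have pj := ord_pred_neq n_gt1 j.
move: gap; case: eqP => _ gap.
  apply: (alternant_affine_eq0 N0 ec (i := j) (j := ord_pred j)).
    by rewrite eq_sym.
  by rewrite /indic jI (negPf pjI) /=; lra.
by apply: (alternant_eq0 _ _ pj); rewrite /indic jI (negPf pjI) /=; lra.
Qed.

Lemma elsym_alternant_coord r m c : (\sum_i m i = k)%N -> \sum_i c i = 0 ->
    (exists ka : R, exists y : 'I_n -> int, forall i, c i = ka + (y i)%:~R) ->
  elsym N r c * alternant N c (coord m)
    = \sum_(p : Pplus n k) (nstep r m p)%:R * alternant N c (coord p).
Proof.
move=> mk c0 ec; rewrite elsym_alternant.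
under eq_bigr do rewrite alternant_step //.
rewrite exchange_big; apply: eq_bigr => p _ /=; rewrite -mulr_suml; congr (_ * _).
by rewrite -natr_sum /nstep -sum1dep_card [in RHS]big_mkcondr.
Qed.

End Pieri.
End Steps.

(** * Orthogonality of distinct columns *)

Lemma card_set_ltn n i : (i <= n)%N -> #|[set j : 'I_n | (j < i)%N]| = i.
Proof.
move=> le; rewrite -sum1dep_card -[RHS]card_ord -sum1_card.
by rewrite (big_ord_widen _ (fun=> 1%N) le); apply: eq_bigl.
Qed.

Lemma increasing_perm_id n (s : 'S_n) :
  (forall i j : 'I_n, (i < j)%N -> (s i < s j)%N) -> s = 1%g.
Proof.
move=> inc; have mono i j : (s i < s j)%N = (i < j)%N.
  case: (ltngtP i j) => [/inc //|/inc|/val_inj->]; last by rewrite ltnn.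
  by move=> h; apply/negbTE; rewrite -leqNgt ltnW.
apply/permP => i; rewrite perm1; apply: val_inj => /=.
rewrite -[LHS](card_set_ltn (ltnW (ltn_ord (s i)))) -[RHS](card_set_ltn (ltnW (ltn_ord i))).
rewrite -(card_preimset _ (@perm_inj _ s)).
by apply: eq_card => j; rewrite !inE mono.
Qed.

Lemma decreasing_rearrangement (d : Order.disp_t) (T : porderType d) n
    (u v : 'I_n -> T) (s : 'S_n) :
    (forall i j : 'I_n, (i < j)%N -> (u j < u i)%O) ->
    (forall i j : 'I_n, (i < j)%N -> (v j < v i)%O) ->
  (forall i, u i = v (s i)) -> s = 1%g.
Proof.
move=> du dv uv; apply: increasing_perm_id => i j ij.
have := du i j ij; rewrite !uv; case: ltngtP => [//|/dv h1 h2|/val_inj->].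
  by have := lt_trans h1 h2; rewrite ltxx.
by rewrite ltxx.
Qed.

Section Orthogonality.
Variables (R : realType) (n k : nat).
Hypothesis n_gt1 : (1 < n)%N.
Local Notation N := (k + n)%N.
Local Notation coord := (shifted_coord R).
Implicit Types (p q : Pplus n k) (c : 'I_n -> R).

Let n_gt0 : (0 < n)%N. Proof. exact: ltnW. Qed.
Let N_gt0 : (0 < N)%N. Proof. by rewrite addn_gt0 n_gt0 orbT. Qed.

Lemma coord_decreasing p (i j : 'I_n) : (i < j)%N -> coord p j < coord p i.
Proof.
by move=> ij; have := coord_window R n_gt1 (sum_Pplus p) ij; rewrite subr_gt0 => /andP[].
Qed.

Lemma coord_inj p q : coord p =1 coord q -> p = q.
Proof.
move=> e; apply: weight_of_Pplus_inj; apply/ffunP => i; apply/eqP.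
have := coord_gap R n_gt1 i (sum_Pplus p); rewrite !e.
rewrite (coord_gap R n_gt1 i (sum_Pplus q)) => /addIr/eqP.
by rewrite eqr_nat eqSS eq_sym.
Qed.

Lemma coord_diff_lt p (i j : 'I_n) : `|coord p i - coord p j| < N%:R.
Proof.
case: (ltngtP i j) => [ij|ji|/val_inj ->].
- by have := coord_window R n_gt1 (sum_Pplus p) ij => /andP[h1 h2]; rewrite gtr0_norm.
- have := coord_window R n_gt1 (sum_Pplus p) ji => /andP[h1 h2].
  by rewrite distrC gtr0_norm.
- by rewrite subrr normr0 ltr0n.
Qed.

Lemma coord_congr_inj p (i j : 'I_n) (z : int) :
  coord p i - coord p j = N%:R * z%:~R -> i = j.
Proof.
move=> e; have := coord_diff_lt p i j; rewrite e normrM normr_nat -[ltRHS]mulr1.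
rewrite ltr_pM2l ?ltr0n // -intr_norm ltrz1 => z1.
have z0 : z = 0 by lia.
move: e; rewrite z0 mulr0 => /eqP; rewrite subr_eq0 => /eqP e.
case: (ltngtP i j) => [/(coord_decreasing p)|/(coord_decreasing p)|/val_inj//];
  by rewrite e ltxx.
Qed.

(** Two coordinate vectors that agree modulo [N] up to order agree: both lie in
  windows of length less than [N], so the integers [z] by which corresponding
  entries differ take at most two consecutive values, and they sum to 0. *)
Lemma coord_congr_eq p q :
    (forall j, exists i, exists z : int, coord p i - coord q j = N%:R * z%:~R) ->
  p = q.
Proof.
move=> congr_pq.
have [w] := fin_all_exists congr_pq; move=> /fin_all_exists[z zP].
have w_inj : injective w.
  move=> i j wij; apply: (coord_congr_inj (p := q) (z := z j - z i)).
  by have := zP i; have := zP j; rewrite wij rmorphB /=; lra.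
have z_sum : \sum_j z j = 0.
  have : \sum_j (coord p (w j) - coord q j) = N%:R * (\sum_j z j)%:~R.
    by rewrite rmorph_sum /= mulr_sumr; apply: eq_bigr => j _; exact: zP.
  rewrite sumrB sum_coord //.
  rewrite -(reindex_inj (P := xpredT) (F := fun i => coord p i) w_inj) sum_coord //.
  rewrite subrr => /esym/eqP; rewrite mulf_eq0 pnatr_eq0 -leqn0 leqNgt N_gt0 /= intr_eq0.
  by move/eqP.
have z_spread i j : z i <= z j + 1.
  rewrite -ltzD1 -(ltr_int R) -(ltr_pM2l (x := N%:R)) ?ltr0n // !rmorphD /=.
  have := coord_diff_lt p (w i) (w j); have := coord_diff_lt q i j.
  rewrite !ltr_norml => /andP[h1 h2] /andP[h3 h4].
  by have := zP i; have := zP j; lra.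
have z_le0 i : z i <= 0.
  rewrite leNgt; apply/negP => zi.
  have z_ge0 j : 0 <= z j by have := z_spread i j; lia.
  have : z i = 0 by apply: (psumr_eq0P _ z_sum).
  by move=> z0; rewrite z0 ltxx in zi.
have z0 i : z i = 0.
  apply/eqP; rewrite -oppr_eq0; apply/eqP.
  apply: (psumr_eq0P (P := xpredT) (F := fun j => - z j)) => // [j _|].
    by rewrite oppr_ge0.
  by rewrite sumrN z_sum oppr0.
have pq j : coord q j = coord p (perm w_inj j).
  by have := zP j; rewrite z0 mulr0 permE => /eqP; rewrite subr_eq0 => /eqP.
have w1 : perm w_inj = 1%g.
  by apply: decreasing_rearrangement pq => i j; exact: coord_decreasing.
by apply: coord_inj => j; rewrite pq w1 perm1.
Qed.

(** As the points have modulus 1 and product 1, the conjugate of the product over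
  a set is the product over its complement. *)
Lemma conj_elsym r c : (r <= n)%N -> \sum_i c i = 0 ->
  ((elsym N (n - r)%N c)^*)%C = elsym N r c.
Proof.
move=> rn c0; rewrite /elsym rmorph_sum (reindex_inj (inv_inj (@setCK _))).
apply: eq_big => [I|I _].
  have -> : #|~: I| = (n - #|I|)%N by rewrite cardsCs setCK card_ord.
  have : (#|I| <= n)%N by rewrite -[leqRHS]card_ord max_card.
  by move: #|I| rn => a rn an; apply/eqP/eqP; lia.
rewrite [LHS]conj_wave; congr wave.
apply/eqP; rewrite eqr_oppLR -addr_eq0 -[X in _ == X]c0 (bigID (mem I) xpredT) /= addrC.
by apply/eqP; congr (_ + _); apply: eq_bigl => i; rewrite inE.
Qed.

Lemma prod_elsym c (T : R[i]) :
  \prod_i (1 + T * wave N (c i)) = \sum_(r < n.+1) T ^+ r * elsym N r c.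
Proof.
under eq_bigr do rewrite addrC.
rewrite bigA_distr (partition_big (fun I : {set 'I_n} => inord #|I| : 'I_n.+1) xpredT) //=.
apply: eq_bigr => r _; rewrite /elsym mulr_sumr.
apply: eq_big => [I|I /eqP rI].
  rewrite -val_eqE /= inordK // ltnS -[X in (_ <= X)%N]card_ord; exact: max_card.
rewrite -big_mkcond /= big_split /= prodr_const wave_sum; congr (T ^+ _ * _).
by rewrite -rI inordK // ltnS -[X in (_ <= X)%N]card_ord; exact: max_card.
Qed.

(** The numbers [elsym N r (coord p)] are the coefficients of a polynomial whose
  roots determine the points [wave (coord p i)], that is, the coordinates of [p]
  up to order and modulo [N]. *)
Lemma elsym_separates p q :
  (forall r, (r <= n)%N -> elsym N r (coord p) = elsym N r (coord q)) -> p = q.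
Proof.
move=> eq_elsym; apply: coord_congr_eq => j.
(* The value of the variable that kills the factor [j] of the product for [q]. *)
pose T := - wave N (- coord q j).
have : \prod_i (1 + T * wave N (coord p i)) = 0.
  rewrite prod_elsym; under eq_bigr => r _ do rewrite eq_elsym ?leq_ord //.
  by rewrite -prod_elsym (bigD1 j) //= /T mulNr [wave _ _ * wave _ _]mulrC waveNK subrr mul0r.
move=> /eqP; rewrite prodf_seq_eq0 => /hasP[i _ /=] /eqP e; exists i.
apply: (wave_eq1 N_gt0); apply/eqP; rewrite waveD -subr_eq0 -oppr_eq0 opprB.
by apply/eqP; rewrite -[RHS]e /T mulNr [X in _ = _ - X]mulrC.
Qed.

Lemma elsym_eigen r p (mu : Pplus n k) :
  elsym N r (coord p) * alternant N (coord p) (coord mu)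
    = \sum_(nu : Pplus n k) (nstep r mu nu)%:R * alternant N (coord p) (coord nu).
Proof.
by apply: elsym_alternant_coord => //;
  [exact: sum_Pplus | exact: sum_coord | exact: coord_int_diff].
Qed.

(** Common eigenvectors of a family of operators closed under adjunction are
  orthogonal as soon as some operator has different eigenvalues on them. *)
Lemma alternant_orthogonal p q : p != q ->
  \sum_(mu : Pplus n k) alternant N (coord p) (coord mu)
     * ((alternant N (coord q) (coord mu))^*)%C = 0.
Proof.
move=> pq; set S := \sum_mu _; apply/eqP; apply: contraNT pq => S0.
apply/eqP/elsym_separates => r rn; apply: (mulIf S0); rewrite /S !mulr_sumr.
under eq_bigr => mu _ do rewrite mulrA elsym_eigen mulr_suml.
rewrite exchange_big; apply: eq_bigr => nu _ /=.
under eq_bigr do rewrite mulrAC mulrC.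
rewrite -mulr_sumr mulrCA; congr (_ * _).
rewrite -(conj_elsym rn) ?sum_coord // -[RHS]rmorphM elsym_eigen rmorph_sum.
by apply: eq_bigr => mu _; rewrite nstep_adjoint // rmorphM [X in _ = X * _]conjc_nat.
Qed.

End Orthogonality.

(** * The norm of a column *)

Section TorusNorm.
Variables (R : realType) (n M : nat) (ka : R) (y : 'I_n -> int) (u : 'I_n -> R).
Local Notation N := M.+1.
Hypothesis u_int : forall i, u i = ka + (y i)%:~R.
Hypothesis y_sep : forall i j, i != j -> (0 < `|y i - y j| < N)%N.
Hypothesis u_sum : \sum_i u i = 0.
Implicit Types (f : {ffun 'I_n -> 'I_N}).

(** The squared modulus of the alternant at a point of the torus [(Z/N)^n]. *)
Definition torus_norm f : R[i] :=
  alternant N u (fun i => (f i)%:R) * ((alternant N u (fun i => (f i)%:R))^*)%C.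

(** Expanding both factors over permutations, the sum over the torus of the term
  of [w] and [w'] is a product of complete character sums, which vanishes unless
  [w = w'] since the entries of [u] are distinct modulo [N]. *)
Lemma torus_norm_total : \sum_f torus_norm f = (N ^ n * n`!)%:R.
Proof.
pose e (w w' : 'S_n) f : R[i] := wave N (\sum_i (u (w i) - u (w' i)) * (f i)%:R).
have expand f : torus_norm f
    = \sum_(w : 'S_n) \sum_(w' : 'S_n) (-1) ^+ w * (-1) ^+ w' * e w w' f.
  rewrite /torus_norm {1}/alternant mulr_suml; apply: eq_bigr => w _.
  rewrite conj_alternant /alternant mulr_sumr; apply: eq_bigr => w' _.
  rewrite mulrACA -waveD; congr (_ * wave _ _).
  by rewrite -big_split; apply: eq_bigr => i _ /=; rewrite mulrN mulrBl.
under eq_bigr do rewrite expand.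
rewrite exchange_big /= [(_ * _)%N]mulnC natrM.
have -> : n`!%:R = \sum_(w : 'S_n) 1 :> R[i].
  by rewrite sumr_const -card_Sn.
rewrite mulr_suml; apply: eq_bigr => w _; rewrite mul1r exchange_big /=.
have sum_e w' : \sum_f e w w' f = (w == w')%:R * (N ^ n)%:R.
  have -> : \sum_f e w w' f = \prod_i \sum_(t < N) wave N ((u (w i) - u (w' i)) * t%:R).
    by rewrite bigA_distr_bigA; apply: eq_bigr => f _; rewrite /e wave_sum.
  case: eqP => [<-|/eqP ww'].
    rewrite mul1r natrX -[in RHS](card_ord n) -prodr_const; apply: eq_bigr => i _.
    under eq_bigr do rewrite subrr mul0r wave0.
    by rewrite sumr_const card_ord.
  have [i wi] : exists i, w i != w' i.
    apply/existsP; apply: contraNT ww'; rewrite negb_exists => /forallP h.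
    by apply/eqP/permP => i; apply/eqP; have := h i; rewrite negbK.
  rewrite (bigD1 i) //= mul0r; apply/eqP; rewrite mulf_eq0; apply/orP; left; apply/eqP.
  rewrite -[RHS](@wave_geometric R N isT _ (y_sep wi)); apply: eq_bigr => t _.
  by congr (wave _ (_ * _)); rewrite !u_int rmorphB /=; ring.
under eq_bigr do rewrite -mulr_sumr sum_e.
rewrite (bigD1 w) //= eqxx mul1r -signr_addb addbb mul1r big1 ?addr0 // => w'.
by rewrite eq_sym => /negPf ->; rewrite mul0r mulr0.
Qed.

(** A translation by [t] as integers is invisible because the entries of [u] sum
  to 0, and the reduction modulo [N] only costs a phase. *)
Lemma torus_norm_translate f (t : 'I_N) : torus_norm [ffun i => f i + t] = torus_norm f.
Proof.
pose z i : int := - ((f i + t) %/ N)%N%:Z.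
have e : alternant N u (fun i => ([ffun i => f i + t] i)%:R)
    = wave N (ka * (N%:R * (\sum_i z i)%:~R)) * alternant N u (fun i => (f i)%:R).
  transitivity (alternant N u (fun i => (f i)%:R + t%:R + N%:R * (z i)%:~R)).
    apply: eq_alternant => // i; rewrite ffunE /z rmorphN /=.
    have := congr1 (fun x => x%:R : R) (divn_eq (f i + t) N).
    rewrite !natrD natrM => d.
    transitivity (((f i + t) %% N)%N%:R : R) => //; rewrite mulrC -pmulrn; lra.
  by rewrite (alternant_lattice _ _ _ u_int) // alternant_translate.
rewrite /torus_norm e rmorphM mulrACA [X in _ * X * _]conj_wave waveNK.
exact: mul1r.
Qed.

Lemma torus_norm_inj f : ~~ injectiveb f -> torus_norm f = 0.
Proof.
move=> /injectivePn[i [j ij fij]].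
by rewrite /torus_norm (alternant_eq0 _ _ ij) ?mul0r // fij.
Qed.

Lemma torus_norm_fiber i (t : 'I_N) :
  \sum_(f : {ffun 'I_n -> 'I_N} | f i == t) torus_norm f
    = \sum_(f : {ffun 'I_n -> 'I_N} | f i == 0) torus_norm f.
Proof.
pose shift (s : 'I_N) f : {ffun 'I_n -> 'I_N} := [ffun j => f j + s].
have shiftK s : cancel (shift s) (shift (- s)).
  by move=> f; apply/ffunP => j; rewrite !ffunE addrK.
rewrite (reindex_inj (can_inj (shiftK t))); apply: eq_big => [f|f _].
  by rewrite ffunE -{2}[t]add0r (inj_eq (addIr _)).
exact: torus_norm_translate.
Qed.

(** For each [i], the points with [f i = 0] carry a fraction [1 / N] of the total.
  An injective point is counted for at most one [i], and the others contribute
  nothing. *)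
Lemma torus_norm_through0 :
  N%:R * \sum_(f : {ffun 'I_n -> 'I_N} | [exists i, f i == 0]) torus_norm f
    = n%:R * (N ^ n * n`!)%:R.
Proof.
have -> : \sum_(f : {ffun 'I_n -> 'I_N} | [exists i, f i == 0]) torus_norm f
    = \sum_i \sum_(f : {ffun 'I_n -> 'I_N} | f i == 0) torus_norm f.
  rewrite (exchange_big_dep xpredT) //= big_mkcond; apply: eq_bigr => f _.
  have [/injectiveP fI|/torus_norm_inj->] := boolP (injectiveb f); last first.
    by rewrite big1_eq; case: ifP.
  case: existsP => [[i /eqP fi]|no].
    rewrite (bigD1 i) ?fi //= big1 ?addr0 // => j /andP[/eqP fj ji].
    by move: ji; rewrite (fI j i) ?eqxx // fi fj.
  by rewrite big1 // => i fi; case: no; exists i.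
have -> : n%:R = #|'I_n|%:R :> R[i] by rewrite card_ord.
rewrite mulr_sumr mulr_natl -sumr_const; apply: eq_bigr => i _.
rewrite -torus_norm_total.
rewrite [RHS](partition_big (fun f : {ffun 'I_n -> 'I_N} => f i) xpredT) //=.
have -> : N%:R = #|'I_N|%:R :> R[i] by rewrite card_ord.
rewrite mulr_natl -sumr_const. apply: eq_bigr => t _; symmetry; exact: torus_norm_fiber.
Qed.

End TorusNorm.

Lemma sorting_perm n (f : 'I_n -> nat) : injective f ->
  exists s : 'S_n, forall i j : 'I_n, (i < j)%N -> (f (s j) < f (s i))%N.
Proof.
move=> f_inj.
have rank_lt i : (#|[set j | (f i < f j)%N]| < n)%N.
  rewrite -[ltnRHS]card_ord -cardsT; apply: proper_card; apply/properP.
  by split; [exact: subsetT | exists i; rewrite ?inE ?ltnn].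
pose rank i := Ordinal (rank_lt i).
have rank_mono i j : (f j < f i)%N -> (rank i < rank j)%N.
  move=> lt; apply: proper_card; apply/properP; split.
    by apply/subsetP => l; rewrite !inE; apply: ltn_trans.
  by exists i; rewrite !inE ?ltnn.
have rank_inj : injective rank.
  move=> i j e; apply: f_inj.
  by case: (ltngtP (f i) (f j)) => // /rank_mono; rewrite e ltnn.
exists (perm rank_inj)^-1%g => i j; set s := (_^-1)%g => ij.
have rK l : rank (s l) = l by rewrite -{2}[l](permKV (perm rank_inj)) permE.
case: (ltngtP (f (s j)) (f (s i))) => // [/rank_mono|/f_inj /perm_inj ji].
  by rewrite !rK ltnNge (ltnW ij).
by rewrite ji ltnn in ij.
Qed.

Section Norm.
Variables (R : realType) (n k M : nat).
Hypothesis n_gt1 : (1 < n)%N.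
Hypothesis N_eq : (k + n = M.+1)%N.
Local Notation N := M.+1.
Local Notation coord := (shifted_coord R).
Implicit Types (p q : Pplus n k) (w : 'S_n).

Let n_gt0 : (0 < n)%N. Proof. exact: ltnW. Qed.

(** The beta-numbers of [p]: a translate of its shifted weight by which it becomes a
  set of [n] residues modulo [N] that contains 0. *)
Definition beta p (i : 'I_n) : nat := row_of_weight p i + (n.-1 - i).

Lemma beta_lt p i : (beta p i < N)%N.
Proof.
rewrite /beta -N_eq; have := row_of_weight_le p i; rewrite sum_Pplus.
by have := ltn_ord i; lia.
Qed.

Lemma beta_decreasing p (i j : 'I_n) : (i < j)%N -> (beta p j < beta p i)%N.
Proof.
move=> ij; have := row_of_weight_anti p (ltnW ij); rewrite /beta.
by have := ltn_ord j; lia.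
Qed.

Lemma beta_coord p : exists t, forall i, (beta p i)%:R = coord p i + t.
Proof.
exists ((beta p (Ordinal n_gt0))%:R - coord p (Ordinal n_gt0)) => i.
have := coordB R p i (Ordinal n_gt0).
have le_i : (i <= n.-1)%N by have := ltn_ord i; lia.
by rewrite /beta !natrD !natrB //=; lra.
Qed.

Definition torus_point (pw : Pplus n k * 'S_n) : {ffun 'I_n -> 'I_N} :=
  [ffun i => Ordinal (beta_lt pw.1 (pw.2 i))].

(** The permutation that matches two decreasing sequences is the identity. *)
Lemma torus_point_inj : injective torus_point.
Proof.
move=> [p w] [q w'] /ffunP e.
have {}e i : beta p (w i) = beta q (w' i) by have := congr1 val (e i); rewrite !ffunE.
have e1 i : beta q i = beta p ((w'^-1 * w)%g i).
  by rewrite permM e permKV.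
have w1 : (w'^-1 * w = 1)%g.
  apply/(decreasing_rearrangement (T := nat)); last exact: e1.
    exact: beta_decreasing.
  exact: beta_decreasing.
have -> : w = w' by apply/eqP; rewrite eq_mulVg1 -(inj_eq invg_inj) invMg invgK w1 invg1.
congr (_, _); apply: (coord_inj (R := R) n_gt1).
have [t pt] := beta_coord p; have [t' qt] := beta_coord q.
apply: (eq_of_gaps n_gt1); first by rewrite !sum_coord.
move=> i _; have := pt i; have := pt (ord_pred i); have := qt i; have := qt (ord_pred i).
by rewrite !e1 w1 !perm1; lra.
Qed.

(** Sorting the entries of [f] in decreasing order and subtracting [n - 1 - i] from
  the entry [i] gives a partition with last row 0 and at most [k] columns. *)
Lemma torus_point_surj (f : {ffun 'I_n -> 'I_N}) :
    injective f -> (exists i, f i = 0) -> exists pw, torus_point pw = f.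
Proof.
move=> f_inj [i0 fi0].
have [|s dec] := @sorting_perm n (fun i => f i); first by move=> i j /val_inj/f_inj.
pose o := Ordinal n_gt0.
pose g j : nat := f (s (insubd o j)).
have gE (i : 'I_n) : g i = f (s i) by rewrite /g valKd.
have g_dec j : (j.+1 < n)%N -> (g j.+1 < g j)%N.
  move=> jn; have := dec (Ordinal (ltnW jn)) (Ordinal jn) (ltnSn j).
  by rewrite -!gE.
have g_lt j : (g j < N)%N by exact: ltn_ord.
have g_last : g n.-1 = 0%N.
  have i0E : g ((s^-1)%g i0) = 0%N by rewrite gE permKV fi0.
  have lt_last : (n.-1 < n)%N by rewrite prednK.
  case: (ltngtP ((s^-1)%g i0) n.-1) => [h|h|<-//].
    by have := dec _ (Ordinal lt_last) h; rewrite permKV fi0.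
  by have := ltn_ord ((s^-1)%g i0); move: h; lia.
have g_ge j : (j < n)%N -> (n.-1 - j <= g j)%N.
  have [d] := ubnP (n.-1 - j)%N; elim: d j => // d IH j dj jn.
  have [jn'|] := ltnP j.+1 n; last by lia.
  by have := g_dec _ jn'; have := IH j.+1; lia.
pose la := mkseq (fun j => (g j - (n.-1 - j))%N) n.
have la_sorted : sorted geq la.
  apply/(sortedP 0%N) => j; rewrite size_mkseq => jn; rewrite !nth_mkseq ?(ltnW jn) //=.
  by have := g_dec _ jn; have := g_ge _ jn; lia.
have la0 : (nth 0 la 0 <= k)%N.
  by rewrite nth_mkseq // subn0; have := g_lt 0%N; lia.
have la_last : nth 0%N la n.-1 = 0%N by rewrite nth_mkseq ?prednK // g_last.
have [p pE] := level_Pplus (hat_level n_gt0 la_sorted la0 la_last).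
exists (p, (s^-1)%g); apply/ffunP => i; rewrite ffunE; apply: val_inj => /=.
rewrite /beta pE row_of_hat // la_last subn0 nth_mkseq // subnK ?g_ge //.
by rewrite gE permKV.
Qed.

(** The sum of the [torus_norm] over the points that meet 0, divided by [n`!] for
  the choice of the permutation. *)
Lemma alternant_norm q :
  \sum_(p : Pplus n k) alternant N (coord q) (coord p)
     * ((alternant N (coord q) (coord p))^*)%C = (n * N ^ n.-1)%:R.
Proof.
have [ka [y qy]] := coord_int_diff R q.
have y_sep i j : i != j -> (0 < `|y i - y j| < N)%N.
  have wlogP (a b : 'I_n) : (a < b)%N -> (0 < `|y a - y b| < N)%N.
    move=> ab; have := coord_window R n_gt1 (sum_Pplus q) ab; rewrite N_eq !qy.
    rewrite opprD addrACA subrr add0r -rmorphB /= ltr0z -[N%:R]/(N%:Z%:~R) ltr_int.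
    by lia.
  case: (ltngtP i j) => [/wlogP//|/wlogP|/val_inj->]; last by rewrite eqxx.
  by rewrite distnC.
have u_sum := sum_coord R n_gt1 q.
have norm_point p w : torus_norm (coord q) (torus_point (p, w))
    = alternant N (coord q) (coord p) * ((alternant N (coord q) (coord p))^*)%C.
  have [t pt] := beta_coord p.
  have e : alternant N (coord q) (fun i => (torus_point (p, w) i)%:R)
      = (-1) ^+ w * alternant N (coord q) (coord p).
    rewrite -(alternant_translate N (coord p) t u_sum) -alternant_perm.
    by apply: eq_alternant => // i; rewrite ffunE /= pt.
  by rewrite /torus_norm e rmorphM rmorph_sign mulrACA -signr_addb addbb mul1r.
have total := torus_norm_through0 qy y_sep u_sum.
have image : \sum_(f : {ffun 'I_n -> 'I_N} | [exists i, f i == 0]) torus_norm (coord q) f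
    = \sum_(f in torus_point @: setT) torus_norm (coord q) f.
  rewrite big_mkcond [RHS]big_mkcond; apply: eq_bigr => f _.
  have [/injectiveP fI|fN] := boolP (injectiveb f); last first.
    by rewrite torus_norm_inj //; do 2 case: ifP.
  congr (if _ then _ else _); apply/existsP/imsetP => [[i /eqP fi]|[[p w] _ ->]].
    by have [|pw <-] := torus_point_surj fI; [exists i | exists pw].
  have lt_last : (n.-1 < n)%N by rewrite prednK.
  exists ((w^-1)%g (Ordinal lt_last)); rewrite ffunE -val_eqE /= permKV.
  by rewrite /beta row_of_weight_last //= subnn.
move: total; rewrite image big_imset; last by move=> a b _ _; exact: torus_point_inj.
rewrite (eq_bigl xpredT) => [|pw]; last by rewrite inE.
rewrite -(pair_bigA _ (fun p w => torus_norm (coord q) (torus_point (p, w)))) /=.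
have inner p : \sum_(w : 'S_n) torus_norm (coord q) (torus_point (p, w))
    = n`!%:R * (alternant N (coord q) (coord p)
                 * ((alternant N (coord q) (coord p))^*)%C).
  by under eq_bigr do rewrite norm_point; rewrite sumr_const -card_Sn mulr_natl.
under eq_bigr do rewrite inner.
rewrite -mulr_sumr mulrA -natrM => total.
have fact_neq0 : (N * n`!)%:R != 0 :> R[i].
  by rewrite pnatr_eq0 muln_eq0 negb_or -!lt0n fact_gt0.
apply: (mulfI fact_neq0); rewrite total -!natrM; congr _%:R.
by rewrite -[in (N ^ n)%N](prednK n_gt0) expnS; nia.
Qed.

End Norm.

(** * Fusion with a fundamental weight *)

Lemma bin2_succ n : 'C(n.+1, 2) = ('C(n, 2) + n)%N.
Proof. by rewrite binS bin1 addnC. Qed.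

Definition rev_perm n : 'S_n := perm (@rev_ord_inj n).

Lemma odd_rev_perm n : odd_perm (rev_perm n) = odd 'C(n, 2).
Proof.
elim: n => [|n IH].
  by rewrite (_ : rev_perm 0 = 1%g) ?odd_perm1 //; apply/permP => -[].
have -> : rev_perm n.+1 = lift_perm ord0 ord_max (rev_perm n).
  apply/permP => i; rewrite permE; apply: val_inj.
  case: (unliftP ord0 i) => [j|] -> /=; last by rewrite lift_perm_id subn1.
  by rewrite lift_perm_lift lift_max permE.
by rewrite odd_lift_perm IH bin2_succ oddD /= addbC.
Qed.

Section ShiftedRows.
Variables (R : realType) (n N : nat).
Implicit Types (c : 'I_n -> R) (b : 'I_n -> nat).

(** The vector [la + rho], up to a common translation, for a partition with rows
  [b i]. *)
Definition shifted_rows b : 'I_n -> R := fun i => (b i)%:R - i%:R.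

Lemma alternant_shifted_rows_eq0 c b (i j : 'I_n) :
  j = i.+1 :> nat -> b j = (b i).+1 -> alternant N c (shifted_rows b) = 0.
Proof.
move=> ij bij; apply: (alternant_eq0 _ _ (i := i) (j := j)).
  by rewrite -val_eqE /= ij; apply/eqP; lia.
by rewrite /shifted_rows bij ij -!natr1; ring.
Qed.

Lemma alternant_vandermonde c :
  alternant N c (shifted_rows (fun=> 0%N))
    = \det (Vandermonde n (\row_i wave N (- c i))).
Proof.
apply: eq_bigr => w _; congr (_ * _); rewrite wave_sum; apply: eq_bigr => i _.
by rewrite !mxE wave_exp /shifted_rows sub0r mulrN mulNr.
Qed.

End ShiftedRows.

Section Fusion.
Variables (R : realType) (n k : nat).
Hypothesis n_gt1 : (1 < n)%N.
Local Notation N := (k + n)%N.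
Local Notation coord := (shifted_coord R).
Implicit Types (p q : Pplus n k) (c : 'I_n -> R) (m : weight n) (b : 'I_n -> nat).

Let n_gt0 : (0 < n)%N. Proof. exact: ltnW. Qed.
Let N_gt0 : (0 < N)%N. Proof. by rewrite addn_gt0 n_gt0 orbT. Qed.

Lemma unitary_scale_neq0 : (n * N ^ n.-1)%:R != 0 :> R[i].
Proof. by rewrite pnatr_eq0 muln_eq0 negb_or -!lt0n n_gt0 expn_gt0 N_gt0. Qed.

(** The S-matrix is unitary; its symmetry exchanges the roles of rows and
  columns in the results of the two preceding parts. *)
Lemma alternant_unitary p q :
  \sum_(si : Pplus n k) alternant N (coord si) (coord p)
      * ((alternant N (coord si) (coord q))^*)%C
    = (p == q)%:R * (n * N ^ n.-1)%:R.
Proof.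
under eq_bigr do rewrite alternantC [alternant _ _ (coord q)]alternantC.
case: eqP => [->|/eqP pq]; last by rewrite mul0r alternant_orthogonal.
have N_eq : N = N.-1.+1 by rewrite prednK.
by rewrite mul1r N_eq; apply: (alternant_norm R n_gt1 N_eq).
Qed.

Lemma coord_dual m i : coord (dual_weight m) i = - coord m (rev_ord i).
Proof.
apply: (eq_of_gaps n_gt1 (v := fun i => - coord m (rev_ord i))) => [|j j0].
  rewrite sum_coord // sumrN -(reindex_inj (P := xpredT) (F := coord m) (@rev_ord_inj n)).
  by rewrite sum_coord // oppr0.
have jj : ordS (rev_ord j) = rev_ord (ord_pred j).
  apply: val_inj; have := val_ord_pred j0; have := ltn_ord j; move: j0 => /= j0 jn ->.
  by rewrite modn_small; lia.
have jp : ord_pred (rev_ord (ord_pred j)) = rev_ord j by rewrite -jj ordSK.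
have j1 : val (rev_ord (ord_pred j)) != 0%N.
  have := val_ord_pred j0; have := ltn_ord j; move: j0 => /= j0 jn ->; lia.
have := coord_gap R n_gt1 j (erefl (\sum_l dual_weight m l)%N).
rewrite (negPf j0) subr0 => ->; rewrite ffunE jj.
have := coord_gap R n_gt1 (rev_ord (ord_pred j)) (erefl (\sum_l m l)%N).
by rewrite (negPf j1) subr0 jp; lra.
Qed.

(** The shifted dual weight is the opposite of the shifted weight in reverse
  order. *)
Lemma alternant_dual c m :
  alternant N c (coord (dual_weight m))
    = (-1) ^+ 'C(n, 2) * ((alternant N c (coord m))^*)%C.
Proof.
rewrite conj_alternant -[(-1) ^+ 'C(n, 2)]signr_odd -odd_rev_perm -alternant_perm.
by apply: eq_alternant => // i; rewrite /= permE coord_dual.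
Qed.

Lemma alternant_hat c (s : seq nat) : sorted geq s -> \sum_i c i = 0 ->
  alternant N c (coord (hat n k s))
    = alternant N c (shifted_rows R (fun i => nth 0%N s i)).
Proof.
move=> ss c0.
pose t : R := - (nth 0%N s n.-1)%:R
  - (\sum_(j < n) row_of_weight (hat n k s) j)%:R / n%:R + n.+1%:R / 2 - 1.
rewrite -[RHS](alternant_translate N _ t c0); apply: eq_alternant => // i.
rewrite /shifted_coord row_of_hat // natrB.
  by rewrite /shifted_rows /t -[i.+1%:R]natr1; ring.
by apply: nth_anti => //; have := ltn_ord i; lia.
Qed.

Lemma alternant_vacuum c : \sum_i c i = 0 ->
  alternant N c (coord (vacuum n k)) = alternant N c (shifted_rows R (fun=> 0%N)).
Proof.
move=> c0; rewrite (_ : vacuum n k = hat n k [::]) ?alternant_hat //.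
  by apply: eq_alternant => // i; rewrite /shifted_rows nth_nil.
by apply/ffunP => i; rewrite !ffunE !nth_nil subn0.
Qed.

Lemma alternant_vacuum_neq0 p : alternant N (coord p) (coord (vacuum n k)) != 0.
Proof.
rewrite alternant_vacuum ?sum_coord // alternant_vandermonde det_Vandermonde.
apply/prodf_neq0 => i _; apply/prodf_neq0 => j ij; rewrite !mxE subr_eq0.
apply/eqP => e.
have [z pz] : exists z : int, coord p i - coord p j = N%:R * z%:~R.
  by apply: (wave_eq1 N_gt0); rewrite waveD e waveNK.
by move: ij; rewrite (coord_congr_inj n_gt1 pz) ltnn.
Qed.

(** Among the strips of size [r] attached to the empty partition, only the
  column survives. *)
Lemma alternant_column c r : (r < n)%N -> \sum_i c i = 0 ->
  alternant N c (coord (hat n k (nseq r 1%N)))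
    = elsym N r c * alternant N c (coord (vacuum n k)).
Proof.
move=> rn c0; rewrite alternant_vacuum // elsym_alternant.
rewrite alternant_hat //; last first.
  apply/(sortedP 0%N) => i; rewrite size_nseq => ir.
  by rewrite !nth_nseq ir (ltnW ir) /=.
pose I0 := [set i : 'I_n | (i < r)%N].
have I0_card : #|I0| = r := card_set_ltn (ltnW rn).
rewrite (bigD1 I0) ?I0_card //= big1 ?addr0 => [|I /andP[/eqP Ir II0]].
  apply: eq_alternant => // i; rewrite /shifted_rows /indic nth_nseq /I0 inE.
  by case: ltnP => _ /=; ring.
(* A set other than [I0] skips a row and then takes the next one. *)
have [j jI jN] : exists2 j : 'I_n, j \in I & (0 < j)%N && (ord_pred j \notin I).
  apply/exists_inP; apply: contraNT II0 => /exists_inPn h.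
  rewrite eqEcard I0_card Ir leqnn andbT; apply/subsetP => i iI; rewrite inE -Ir.
  have down d (l : 'I_n) : (l + d)%N = i -> l \in I.
    elim: d l => [|d IH] l li.
      by rewrite (_ : l = i) //; apply: val_inj; rewrite /= -li addn0.
    have lt_l : (l.+1 < n)%N by have := ltn_ord i; lia.
    have next : Ordinal lt_l \in I by apply: IH; rewrite /= -li addSn addnS.
    have pl : ord_pred (Ordinal lt_l) = l by apply: val_inj; rewrite val_ord_pred.
    by have := h _ next; rewrite pl /= negbK.
  rewrite -(card_set_ltn (ltn_ord i)).
  apply: subset_leq_card; apply/subsetP => l; rewrite inE ltnS => li.
  by apply: (down (i - l)%N); rewrite subnKC.
move: jN => /andP[j0 pjI]; have j0' : val j != 0%N by rewrite -lt0n.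
pose rI (i : 'I_n) := (i \in I : nat).
transitivity (alternant N c (shifted_rows R rI)).
  by apply: eq_alternant => // i; rewrite /shifted_rows /indic /rI; ring.
apply: (@alternant_shifted_rows_eq0 _ _ _ _ _ (ord_pred j) j).
  by have := val_ord_pred j0' => /= ->; rewrite prednK.
by rewrite /rI jI (negPf pjI).
Qed.

(** The square of the prefactor of [Smat] is [1 / (n N ^ (n - 1))] up to the sign
  [(-1) ^ (n (n - 1) / 2)], and this is also the sign of the reversal of [n]
  entries, which enters through the dual weight. *)
Lemma fusionE la mu nu :
  fusion R k la mu nu = (n * N ^ n.-1)%:R^-1 *
    \sum_(si : Pplus n k) alternant N (coord si) (coord la)
        / alternant N (coord si) (coord (vacuum n k))
      * (alternant N (coord si) (coord mu) * ((alternant N (coord si) (coord nu))^*)%C).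
Proof.
pose z : R[i] := expi (pi * n%:R * (n%:R - 1) / 4)
  / ((Num.sqrt (n%:R * N%:R ^+ n.-1))%:C)%C.
have SE m p : Smat R k m p = z * alternant N (coord p) (coord m).
  rewrite /Smat -/z; congr (_ * _); exact: eq_bigr.
have z2 : z * z * (-1) ^+ 'C(n, 2) = (n * N ^ n.-1)%:R^-1.
  rewrite /z mulrACA -invfM -expiD -rmorphM /= -expr2 sqr_sqrtr; last first.
    by rewrite mulr_ge0 ?exprn_ge0 ?ler0n.
  have -> : pi * n%:R * (n%:R - 1) / 4 + pi * n%:R * (n%:R - 1) / 4 = pi *+ 'C(n, 2) :> R.
    have -> : pi *+ 'C(n, 2) = pi * (n%:R * (n%:R - 1) / 2) :> R.
      rewrite -[LHS]mulr_natr; congr (_ * _).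
      elim: (n) => [|d IH]; first by rewrite !mul0r.
      by rewrite bin2_succ natrD IH -natr1; field.
    by field.
  rewrite expi_mulrn expi_pi mulrAC -expr2 sqrr_sign mul1r; congr (_^-1).
  by rewrite -natrX -natrM rmorph_nat.
have z_neq0 : z != 0.
  by apply: contraNneq unitary_scale_neq0 => z0; rewrite -invr_eq0 -z2 z0 !mul0r.
rewrite /fusion mulr_sumr; apply: eq_bigr => si _; rewrite !SE alternant_dual -z2.
have := alternant_vacuum_neq0 si; set v := alternant _ _ (coord (vacuum n k)) => v0.
by field; rewrite z_neq0 v0.
Qed.

(** Unitarity inverts the eigenvalue equation [elsym_eigen]. *)
Lemma fusion_column r m m' : (r < n)%N ->
    (\sum_i m i = k)%N -> (\sum_i m' i = k)%N ->
  fusion R k (hat n k (nseq r 1%N)) m m' = (nstep r m m')%:R.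
Proof.
move=> rn /level_Pplus[p <-] /level_Pplus[q <-]; rewrite fusionE.
apply: (mulfI unitary_scale_neq0); rewrite mulVKf ?unitary_scale_neq0 //.
under eq_bigr => si _.
  rewrite alternant_column ?sum_coord // mulfK ?alternant_vacuum_neq0 //.
  rewrite mulrA elsym_eigen // mulr_suml.
  over.
rewrite exchange_big /=.
under eq_bigr => nu _.
  under eq_bigr do rewrite -mulrA.
  rewrite -mulr_sumr alternant_unitary; over.
rewrite (bigD1 q) //= eqxx mul1r big1 ?addr0 => [|nu /negPf->]; first by rewrite mulrC.
by rewrite mul0r mulr0.
Qed.

End Fusion.

(** * Products of elementary symmetric polynomials *)

Section BoxPartitions.
Local Open Scope nat_scope.
Variables r c : nat.

Lemma size_boxpart (la : boxpart r c) : size la = r.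
Proof. by rewrite size_map size_tuple. Qed.

Lemma boxpart_sorted (la : boxpart r c) : sorted geq la.
Proof. by case: la. Qed.

Lemma boxpart_le (la : boxpart r c) i : nth 0 la i <= c.
Proof.
have [lt|ge] := ltnP i (size la); last by rewrite nth_default.
have /mapP[x _ ->] := mem_nth 0 lt; exact: ltn_ord x.
Qed.

Lemma boxpart_eq (la mu : boxpart r c) :
  (forall i : 'I_r, nth 0 la i = nth 0 mu i) -> la = mu.
Proof.
move=> e; apply: val_inj; apply: val_inj; apply: (inj_map val_inj) => /=.
apply: (@eq_from_nth _ 0); first by rewrite !size_boxpart.
by move=> i; rewrite size_boxpart => ir; exact: (e (Ordinal ir)).
Qed.

Lemma boxpart_exists (b : nat -> nat) :
    (forall i, i.+1 < r -> b i.+1 <= b i) -> (forall i, i < r -> b i <= c) ->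
  exists la : boxpart r c, forall i, i < r -> nth 0 la i = b i.
Proof.
move=> anti le; pose t := [tuple (inord (b i) : 'I_c.+1) | i < r].
have tE : map val t = mkseq b r.
  rewrite -map_comp /mkseq -val_enum_ord -map_comp; apply: eq_map => i /=.
  by rewrite inordK // ltnS le.
have ts : sorted geq (map val t).
  rewrite tE; apply/(sortedP 0) => i; rewrite size_mkseq => ir.
  by rewrite !nth_mkseq ?(ltnW ir) //=; exact: anti.
by exists (BoxPart ts) => i ir; rewrite /seq_of_boxpart /= tE nth_mkseq.
Qed.

End BoxPartitions.

Section FfunRcons.
Variables (T : finType) (l : nat).

Definition ffun_rcons (g : {ffun 'I_l -> T}) (t : T) : {ffun 'I_l.+1 -> T} :=
  [ffun i => oapp g t (unlift ord_max i)].

Lemma ffun_rcons_max g t : ffun_rcons g t ord_max = t.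
Proof. by rewrite ffunE unlift_none. Qed.

Lemma ffun_rcons_widen g t i : ffun_rcons g t (widen_ord (leqnSn l) i) = g i.
Proof.
rewrite (_ : widen_ord _ i = lift ord_max i) ?ffunE ?liftK //.
by apply: val_inj; rewrite [RHS]lift_max.
Qed.

Lemma ffun_rcons_val g t (i : 'I_l.+1) (j : 'I_l) :
  i = j :> nat -> ffun_rcons g t i = g j.
Proof. by move=> ij; rewrite -(ffun_rcons_widen g t); congr (_ _); apply: val_inj. Qed.

Lemma big_ffun_rcons (V : nmodType) (P : pred {ffun 'I_l.+1 -> T})
    (F : {ffun 'I_l.+1 -> T} -> V) :
  \sum_(f | P f) F f = \sum_g \sum_(t | P (ffun_rcons g t)) F (ffun_rcons g t).
Proof.
rewrite pair_big_dep /=.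
rewrite (reindex (fun p : {ffun 'I_l -> T} * T => ffun_rcons p.1 p.2)) //=.
exists (fun f : {ffun 'I_l.+1 -> T} =>
  ([ffun i => f (widen_ord (leqnSn l) i)], f ord_max)).
  move=> [g t] _; rewrite ffun_rcons_max; congr (_, _).
  by apply/ffunP => i; rewrite ffunE ffun_rcons_widen.
move=> f _; apply/ffunP => i /=; case: (unliftP ord_max i) => [j ->|->].
  rewrite (ffun_rcons_val _ _ (j := j)) ?ffunE ?lift_max //.
  by congr (f _); apply: val_inj; rewrite [RHS]lift_max.
by rewrite ffun_rcons_max.
Qed.

End FfunRcons.

Lemma forall_ord_recr l (P : pred 'I_l.+1) :
  [forall i, P i] = [forall i : 'I_l, P (widen_ord (leqnSn l) i)] && P ord_max.
Proof.
apply/forallP/andP => [h|[/forallP h hm] i]; first by split=> //; apply/forallP => i.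
have [il|] := ltnP i l.
  by rewrite (_ : i = widen_ord (leqnSn l) (Ordinal il)) //; apply: val_inj.
move=> li; rewrite (_ : i = ord_max) //; apply: val_inj; apply/eqP.
by rewrite eqn_leq -ltnS ltn_ord.
Qed.

(** A walk [B : {ffun 'I_l -> {set 'I_n}}] builds a partition from the empty one
  by adding at time [p] one box to each row in [B p]. *)
Section Walks.
Local Open Scope nat_scope.
Variable n : nat.

Definition antitone (b : 'I_n -> nat) : bool :=
  [forall i : 'I_n, forall j : 'I_n, (j == i.+1 :> nat) ==> (b j <= b i)].

Lemma antitone_le b (i j : 'I_n) : antitone b -> i <= j -> b j <= b i.
Proof.
move=> /forallP anti ij.
have step (a d : 'I_n) : d = a.+1 :> nat -> b d <= b a.
  by move=> e; have /forallP/(_ d) := anti a; rewrite e eqxx.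
have E d (a : 'I_n) : a + d = j -> b j <= b a.
  elim: d a => [|d IH] a ad.
    by rewrite (_ : a = j) //; apply: val_inj; rewrite /= -ad addn0.
  have lt : a.+1 < n by have := ltn_ord j; lia.
  apply: (leq_trans (IH (Ordinal lt) _) (step a (Ordinal lt) _)) => //=.
  by rewrite -ad addSn addnS.
by apply: (E (j - i)); rewrite subnKC.
Qed.

Section Length.
Variable l : nat.
Implicit Types (B : {ffun 'I_l -> {set 'I_n}}) (i : 'I_n).

Definition walk_rows B p i : nat := \sum_(q < l | q < p) (i \in B q).

Definition dominant_walk B := [forall p : 'I_l.+1, antitone (walk_rows B p)].

Definition walk_content B (al : 'I_l -> nat) := [forall p, #|B p| == al p].

Lemma walk_rowsS B (q : 'I_l) i : walk_rows B q.+1 i = walk_rows B q i + (i \in B q).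
Proof.
rewrite /walk_rows (bigD1 q) //= addnC; congr addn; apply: eq_bigl => j.
by rewrite ltnS -val_eqE /= andbC ltn_neqAle.
Qed.

Lemma walk_rows_mono B p p' i : p <= p' -> walk_rows B p i <= walk_rows B p' i.
Proof.
move=> pp; rewrite /walk_rows [leqLHS]big_mkcond [leqRHS]big_mkcond /=.
by apply: leq_sum => q _; case: ifP => // qp; rewrite (leq_trans qp pp).
Qed.

Lemma walk_rows_le B p i : walk_rows B p i <= l.
Proof.
rewrite -[leqRHS]card_ord -sum1_card /walk_rows big_mkcond.
by apply: leq_sum => q _; case: ifP => // _; apply: leq_b1.
Qed.

Lemma walk_rows0 B i : walk_rows B 0 i = 0.
Proof. by rewrite /walk_rows big_pred0. Qed.

(** A row grows by at most one box at each step, so it passes through every length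
  below its final one. *)
Lemma walk_step_exists B i j : j < walk_rows B l i ->
  exists q : 'I_l, (i \in B q) && (walk_rows B q i == j).
Proof.
suff E p : p <= l -> j < walk_rows B p i ->
    exists q : 'I_l, (i \in B q) && (walk_rows B q i == j) by exact: E.
elim: p => [|p IH] pl; first by rewrite walk_rows0.
have := walk_rowsS B (Ordinal pl) i => /= ->.
have [/(IH (ltnW pl)) //|le] := ltnP j (walk_rows B p i).
case: (boolP (i \in _)) => [iB|_]; last by rewrite addn0 ltnNge le.
rewrite addn1 ltnS => ge; exists (Ordinal pl); rewrite iB /=.
by rewrite eqn_leq le ge.
Qed.

Lemma walk_step_lt B i (q q' : 'I_l) : i \in B q ->
  walk_rows B q i < walk_rows B q' i -> q < q'.
Proof.
move=> iB lt; rewrite ltnNge; apply/negP => /(walk_rows_mono B i) le.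
by move: lt; rewrite ltnNge le.
Qed.

Lemma walk_step_uniq B i (q q' : 'I_l) : i \in B q -> i \in B q' ->
  walk_rows B q i = walk_rows B q' i -> q = q'.
Proof.
have half (a d : 'I_l) : i \in B a -> walk_rows B a i = walk_rows B d i -> d <= a.
  move=> iB e; rewrite leqNgt; apply/negP => /(walk_rows_mono B i).
  by rewrite walk_rowsS iB e addn1 ltnn.
by move=> iq iq' e; apply: val_inj; apply/eqP; rewrite eqn_leq !half.
Qed.

End Length.

Lemma walk_rows_rcons l (B : {ffun 'I_l -> {set 'I_n}}) I p i : p <= l ->
  walk_rows (ffun_rcons B I) p i = walk_rows B p i.
Proof.
move=> pl; rewrite /walk_rows big_mkcond big_ord_recr /= ltnNge pl addn0.
rewrite [RHS]big_mkcond; apply: eq_bigr => q _.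
by rewrite ffun_rcons_widen.
Qed.

Lemma walk_rows_rcons_max l (B : {ffun 'I_l -> {set 'I_n}}) I i :
  walk_rows (ffun_rcons B I) l.+1 i = walk_rows B l i + (i \in I).
Proof.
have := walk_rowsS (ffun_rcons B I) ord_max i => /= ->.
by rewrite walk_rows_rcons // ffun_rcons_max.
Qed.

Lemma eq_antitone b b' : b =1 b' -> antitone b = antitone b'.
Proof. by move=> e; apply: eq_forallb => i; apply: eq_forallb => j; rewrite !e. Qed.

Lemma dominant_rcons l (B : {ffun 'I_l -> {set 'I_n}}) I :
  dominant_walk (ffun_rcons B I)
    = dominant_walk B && antitone (fun i => walk_rows B l i + (i \in I)).
Proof.
rewrite /dominant_walk forall_ord_recr; congr andb.
  apply: eq_forallb => p; apply: eq_antitone => i.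
  exact: walk_rows_rcons (leq_ord p).
by apply: eq_antitone => i; rewrite walk_rows_rcons_max.
Qed.

Lemma content_rcons l (B : {ffun 'I_l -> {set 'I_n}}) I (al : 'I_l.+1 -> nat) :
  walk_content (ffun_rcons B I) al
    = walk_content B (fun p => al (widen_ord (leqnSn l) p)) && (#|I| == al ord_max).
Proof.
rewrite /walk_content forall_ord_recr ffun_rcons_max; congr andb.
by apply: eq_forallb => p; rewrite ffun_rcons_widen.
Qed.

End Walks.

Section Expansion.
Variables (R : realType) (n N : nat).
Implicit Types (c : 'I_n -> R).

(** The Pieri rule is iterated from the empty partition; a set of boxes that breaks
  the order of two consecutive rows makes two shifted rows equal. *)
Lemma prod_elsym_walks l (al : 'I_l -> nat) c :
  (\prod_p elsym N (al p) c) * alternant N c (shifted_rows R (fun=> 0%N))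
    = \sum_(B : {ffun 'I_l -> {set 'I_n}} | dominant_walk B && walk_content B al)
        alternant N c (shifted_rows R (walk_rows B l)).
Proof.
elim: l al => [|l IH] al.
  have B0 (B : {ffun 'I_0 -> {set 'I_n}}) : B = [ffun=> set0] by apply/ffunP => -[].
  rewrite big_ord0 mul1r (bigD1 [ffun=> set0]) /= => [|].
    rewrite big1 ?addr0 => [|B]; last by rewrite (B0 B) eqxx andbF.
    by apply: eq_alternant => // i; rewrite /shifted_rows walk_rows0.
  rewrite /dominant_walk /walk_content; apply/andP; split; last by apply/forallP => -[].
  apply/forallP => -[[|//] ?]; apply/forallP => i; apply/forallP => j.
  by rewrite !walk_rows0 leqnn implybT.
rewrite big_ord_recr /= mulrAC IH mulr_suml big_ffun_rcons /=.
rewrite [LHS]big_mkcond; apply: eq_bigr => B _.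
case: ifP => [/andP[domB contB]|noB]; last first.
  rewrite big1 // => I; rewrite dominant_rcons content_rcons.
  move=> /andP[/andP[d _] /andP[ct _]].
  by rewrite d ct in noB.
rewrite mulrC elsym_alternant big_mkcond [RHS]big_mkcond; apply: eq_bigr => I _.
rewrite dominant_rcons content_rcons domB contB /= andbC.
case: eqP => //= _; set b := fun i => (_ + _)%N.
have -> : alternant N c (fun i => shifted_rows R (walk_rows B l) i + indic R I i)
    = alternant N c (shifted_rows R b).
  by apply: eq_alternant => // i; rewrite /shifted_rows /indic /b natrD; ring.
case: ifP => [_|].
  by apply: eq_alternant => // i; rewrite /shifted_rows walk_rows_rcons_max.
move=> /negbT/forallPn[i /forallPn[j]]; rewrite negb_imply -ltnNge => /andP[/eqP ij gt].
apply: (@alternant_shifted_rows_eq0 _ _ _ _ _ _ _ ij).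
have le : (walk_rows B l j <= walk_rows B l i)%N.
  by have /forallP/(_ ord_max)/antitone_le := domB; apply; rewrite ij leqnSn.
move: gt le; rewrite /b.
by case: (j \in I); case: (i \in I); rewrite /= ?addn0 ?addn1; lia.
Qed.

End Expansion.

(** * Tableaux as walks *)

Section ConjPart.
Local Open Scope nat_scope.

Lemma count_gt_anti (s : seq nat) i j : sorted geq s ->
  (i < count (fun x => j < x) s) = (j < nth 0 s i).
Proof.
elim: s i => [|x s IH] i; first by rewrite nth_nil.
rewrite /= (path_sortedE (leT := geq)) => [/andP[/allP xs ss]|]; last first.
  by move=> a b d ab bd; apply: leq_trans bd ab.
case: (ltnP j x) => jx; first by case: i => [|i] //=; rewrite add1n ltnS IH.
have -> : count (fun x => j < x) s = 0.
  apply/eqP; rewrite -leqn0 leqNgt -has_count; apply/hasPn => z /xs zx.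
  by rewrite -leqNgt (leq_trans zx jx).
rewrite addn0 ltn0; apply/esym/negbTE; rewrite -leqNgt.
case: i => [|i] //=; have [lt|ge] := ltnP i (size s); last by rewrite nth_default.
exact: leq_trans (xs _ (mem_nth 0 lt)) jx.
Qed.

Lemma nth_conj_part (s : seq nat) i j : sorted geq s ->
  (i < nth 0 (conj_part s) j) = (j < nth 0 s i).
Proof.
move=> ss; rewrite /conj_part -nth0.
have [lt|ge] := ltnP j (nth 0 s 0).
  by rewrite (nth_map 0) ?size_iota // nth_iota // count_gt_anti.
rewrite nth_default ?size_map ?size_iota // ltn0; apply/esym/negbTE.
by rewrite -leqNgt (leq_trans _ ge) // nth_anti.
Qed.

Lemma size_conj_part (s : seq nat) : size (conj_part s) = nth 0 s 0.
Proof. by rewrite size_map size_iota nth0. Qed.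

End ConjPart.

Lemma card_inverse_on (T U : finType) (A : {set T}) (B : {set U})
    (f : T -> U) (g : U -> T) :
    {in A, forall x, f x \in B} -> {in B, forall y, g y \in A} ->
    {in A, cancel f g} -> {in B, cancel g f} ->
  #|A| = #|B|.
Proof.
move=> fAB gBA fK gK; rewrite -(card_in_imset (can_in_inj fK)); apply: eq_card => y.
apply/imsetP/idP => [[x xA ->]|yB]; first exact: fAB.
by exists (g y); [exact: gBA | rewrite gK].
Qed.

(** In a semistandard tableau of the transposed shape, column [i] is row [i] of
  [la], and its strictly increasing entries are taken as the times at which a
  box is added to row [i]; that rows of the tableau weakly increase then says
  that the row lengths remain ordered at all times. *)
Section Tableaux.
Local Open Scope nat_scope.
Variables (n l : nat) (la : boxpart n l).
Hypothesis l_gt0 : 0 < l.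
Local Notation sh := (conj_part la).
Implicit Types (x y : cell sh) (T : {ffun cell sh -> 'I_l}).
Implicit Types (B : {ffun 'I_l -> {set 'I_n}}).

Let la_sorted := boxpart_sorted la.

Definition cell_row x : nat := (val x).1.
Definition cell_col x : nat := (val x).2.

Lemma cell_lt x : cell_row x < nth 0 la (cell_col x).
Proof. by rewrite -nth_conj_part //; exact: (valP x). Qed.

Lemma cell_col_lt x : cell_col x < n.
Proof.
rewrite -(size_boxpart la) ltnNge; apply/negP => ge.
by have := cell_lt x; rewrite nth_default.
Qed.

Definition cell_colo x : 'I_n := Ordinal (cell_col_lt x).

Lemma cell_eq x y : cell_row x = cell_row y -> cell_col x = cell_col y -> x = y.
Proof.
move=> r c; apply: val_inj; rewrite [val x]surjective_pairing [val y]surjective_pairing.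
by congr (_, _); apply: val_inj.
Qed.

Lemma cell_exists i j : j < nth 0 la i -> exists2 x, cell_row x = j & cell_col x = i.
Proof.
move=> ji.
have hj : j < size sh by rewrite size_conj_part (leq_trans ji) // nth_anti.
have hi : i < head 0 sh by rewrite -nth0 nth_conj_part // (leq_ltn_trans _ ji).
have hx : nth 0 sh (Ordinal hj, Ordinal hi).1 > (Ordinal hj, Ordinal hi).2.
  by rewrite nth_conj_part.
by exists (Sub (Ordinal hj, Ordinal hi) hx); rewrite /cell_row /cell_col SubK.
Qed.

Lemma semistandardP T :
  reflect ((forall x y, cell_row x = cell_row y -> cell_col x <= cell_col y -> T x <= T y)
        /\ (forall x y, cell_col x = cell_col y -> cell_row x < cell_row y -> T x < T y))
    (semistandard T).
Proof.
apply: (iffP forallP) => [h|[hr hc] x].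
  split=> x y e lt; have /forallP/(_ y)/andP[/implyP h1 /implyP h2] := h x.
    by apply: h1; rewrite -val_eqE; apply/andP; split=> //; apply/eqP.
  by apply: h2; rewrite -val_eqE; apply/andP; split=> //; apply/eqP.
apply/forallP => y; apply/andP; split; apply/implyP => /andP[/eqP e lt].
  by apply: hr => //; rewrite /cell_row e.
by apply: hc => //; rewrite /cell_col e.
Qed.

Definition walk_of T : {ffun 'I_l -> {set 'I_n}} :=
  [ffun q => [set i | [exists x, (cell_colo x == i) && (T x == q)]]].

(** The box [x] is filled with the time at which the row [cell_colo x] grows beyond
  the length [cell_row x].  The default is used only if the walk does not lead
  to [la]. *)
Definition tableau_of B : {ffun cell sh -> 'I_l} :=
  [ffun x => odflt (Ordinal l_gt0)
     [pick q | (cell_colo x \in B q) && (walk_rows B q (cell_colo x) == cell_row x)]].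

Lemma mem_walk_of T q i :
  reflect (exists2 x, cell_colo x = i & T x = q) (i \in walk_of T q).
Proof.
rewrite ffunE inE; apply: (iffP existsP) => [[x /andP[/eqP xi /eqP Tx]]|[x xi Tx]].
  by exists x.
by exists x; rewrite xi Tx !eqxx.
Qed.

Lemma card_column_rows (i : 'I_n) j : j <= nth 0 la i ->
  #|[set x | (cell_colo x == i) && (cell_row x < j)]| = j.
Proof.
elim: j => [|j IH] ji; first by apply: eq_card0 => x; rewrite inE andbF.
have [x xj xi] := cell_exists ji.
set S := [set y | (cell_colo y == i) && (cell_row y < j)].
have xS : x \notin S by rewrite inE xj ltnn andbF.
transitivity #|x |: S|; last by rewrite cardsU1 xS IH // ltnW.
apply: eq_card => y; rewrite !inE ltnS leq_eqVlt andb_orr; congr orb.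
apply/andP/eqP => [[/eqP yi /eqP yj]|->].
  by apply: cell_eq; rewrite ?xj ?xi // -yi.
by rewrite xj eqxx -val_eqE /= xi eqxx.
Qed.

Section Semistandard.
Variable T : {ffun cell sh -> 'I_l}.
Hypothesis T_row : forall x y,
  cell_row x = cell_row y -> cell_col x <= cell_col y -> T x <= T y.
Hypothesis T_col : forall x y,
  cell_col x = cell_col y -> cell_row x < cell_row y -> T x < T y.

Lemma column_entries_inj x y : cell_colo x = cell_colo y -> T x = T y -> x = y.
Proof.
move=> /(congr1 val) /= c t; apply: cell_eq => //.
case: (ltngtP (cell_row x) (cell_row y)) => // [/(T_col c)|/(T_col (esym c))];
  by rewrite t ltnn.
Qed.

Lemma column_entries_mono x y : cell_colo x = cell_colo y ->
  (T x < T y) = (cell_row x < cell_row y).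
Proof.
move=> c; have /= c' := congr1 val c.
case: (ltngtP (cell_row x) (cell_row y)) => [/(T_col c')//|/(T_col (esym c'))|r].
  by move=> h; apply/negbTE; rewrite -leqNgt ltnW.
by rewrite (cell_eq r c') ltnn.
Qed.

Lemma walk_rows_walk_of p (i : 'I_n) :
  walk_rows (walk_of T) p i = #|[set x | (cell_colo x == i) && (T x < p)]|.
Proof.
have inj : {in [set x | (cell_colo x == i) && (T x < p)] &, injective T}.
  move=> x y; rewrite !inE => /andP[/eqP xi _] /andP[/eqP yi _].
  by apply: column_entries_inj; rewrite xi yi.
rewrite -(card_in_imset inj) -sum1_card /walk_rows.
rewrite big_mkcond [RHS]big_mkcond /=; apply: eq_bigr => q _.
case: ifP => [qp|qp]; last first.
  by case: imsetP => // -[x]; rewrite inE => /andP[_ xp] qx; rewrite qx xp in qp.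
have -> : (i \in walk_of T q)
    = (q \in [set T x | x in [set x | (cell_colo x == i) && (T x < p)]]).
  apply/mem_walk_of/imsetP => [[x xi Tx]|[x]].
    by exists x; rewrite ?Tx // inE xi eqxx Tx.
  by rewrite inE => /andP[/eqP xi _] ->; exists x.
by case: (q \in _).
Qed.

Lemma walk_of_shape (i : 'I_n) : walk_rows (walk_of T) l i = nth 0 la i.
Proof.
rewrite walk_rows_walk_of -[RHS](card_column_rows (leqnn _)); apply: eq_card => x.
rewrite !inE ltn_ord andbT; case: eqP => //= <-.
by rewrite cell_lt.
Qed.

Lemma walk_of_rank x : walk_rows (walk_of T) (T x) (cell_colo x) = cell_row x.
Proof.
rewrite walk_rows_walk_of -[RHS](@card_column_rows (cell_colo x) _ (ltnW (cell_lt x))).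
apply: eq_card => y; rewrite !inE; case: eqP => //= yx.
exact: column_entries_mono.
Qed.

(** The rows of the entries less than [p] in a column decrease, as sets, from left
  to right. *)
Lemma walk_of_dominant : dominant_walk (walk_of T).
Proof.
apply/forallP => p; apply/forallP => i; apply/forallP => j; apply/implyP => /eqP ij.
rewrite !walk_rows_walk_of.
pose rows (i : 'I_n) := [set (val x).1 | x in [set x | (cell_colo x == i) && (T x < p)]].
have card_rows a : #|rows a| = #|[set x | (cell_colo x == a) && (T x < p)]|.
  apply: card_in_imset => x y; rewrite !inE => /andP[/eqP xa _] /andP[/eqP ya _] e.
  by apply: cell_eq; rewrite /cell_row ?e // -[cell_col x]/(val (cell_colo x)) xa -ya.
rewrite -!card_rows; apply: subset_leq_card; apply/subsetP => r /imsetP[x].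
rewrite inE => /andP[/eqP xj xp] ->.
have [|y yr yi] := @cell_exists i (cell_row x).
  apply: leq_trans (cell_lt x) _; apply: nth_anti => //.
  by rewrite -[cell_col x]/(val (cell_colo x)) xj /= ij.
apply/imsetP; exists y; last by apply: val_inj.
rewrite inE -val_eqE /= yi eqxx (leq_ltn_trans _ xp) // T_row //.
by rewrite yi -[cell_col x]/(val (cell_colo x)) xj /= ij.
Qed.

Lemma card_walk_of q : #|walk_of T q| = #|[set x | T x == q]|.
Proof.
rewrite -(card_in_imset (f := cell_colo)) => [|x y]; last first.
  rewrite !inE => /eqP xq /eqP yq c; apply: column_entries_inj => //.
  by rewrite xq yq.
apply: eq_card => i; apply/mem_walk_of/imsetP => [[x <- Tx]|[x]].
  by exists x; rewrite // inE Tx.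
by rewrite inE => /eqP Tx ->; exists x.
Qed.

Lemma tableau_of_walk_of : tableau_of (walk_of T) = T.
Proof.
apply/ffunP => x; rewrite ffunE.
have mem : cell_colo x \in walk_of T (T x) by apply/mem_walk_of; exists x.
case: pickP => [q /andP[xq /eqP r]|/(_ (T x))] /=; last by rewrite mem walk_of_rank eqxx.
by apply: (walk_step_uniq xq mem); rewrite r walk_of_rank.
Qed.

End Semistandard.

Section Walk.
Variable B : {ffun 'I_l -> {set 'I_n}}.
Hypothesis B_shape : forall i : 'I_n, walk_rows B l i = nth 0 la i.

Lemma tableau_of_spec x :
  (cell_colo x \in B (tableau_of B x))
    && (walk_rows B (tableau_of B x) (cell_colo x) == cell_row x).
Proof.
rewrite ffunE; case: pickP => [q //|/= no].
have lt : cell_row x < walk_rows B l (cell_colo x) by rewrite B_shape cell_lt.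
by have [q] := walk_step_exists lt; rewrite no.
Qed.

Lemma walk_of_tableau_of : walk_of (tableau_of B) = B.
Proof.
apply/ffunP => q; apply/setP => i; apply/mem_walk_of/idP => [[x <- <-]|iq].
  by have /andP[] := tableau_of_spec x.
have [|x xr xi] := @cell_exists i (walk_rows B q i).
  rewrite -B_shape (leq_trans _ (walk_rows_mono _ _ (ltn_ord q))) //.
  by rewrite walk_rowsS iq addn1.
have xi' : cell_colo x = i by apply: val_inj.
exists x => //; have /andP[xq /eqP r] := tableau_of_spec x.
apply: (walk_step_uniq (B := B) (i := i)) => //; first by rewrite -xi'.
by rewrite -{1}xi' r xr.
Qed.

Lemma tableau_of_semistandard : dominant_walk B -> semistandard (tableau_of B).
Proof.
move=> domB; apply/semistandardP; split=> x y e lt;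
  have /andP[xq /eqP xr] := tableau_of_spec x;
  have /andP[yq /eqP yr] := tableau_of_spec y.
  (* If [x] were filled later than [y], then just after time [q] the row of [y]
     would exceed the length [cell_row y], but the row of [x], which lies above
     it, would not. *)
  rewrite leqNgt; apply/negP => gt.
  set q := tableau_of B y in yq yr gt.
  have /forallP/(_ (Ordinal (ltn_ord q : q.+1 < l.+1)))/antitone_le := domB.
  move=> /(_ (cell_colo x) (cell_colo y) lt) /=; rewrite walk_rowsS yq yr addn1.
  move=> h1; have := walk_rows_mono B (cell_colo x) gt; rewrite xr -e in h1 *.
  by move=> h2; have := leq_trans h1 h2; rewrite ltnn.
have c : cell_colo x = cell_colo y by apply: val_inj.
by apply: (walk_step_lt xq); rewrite xr c yr.
Qed.

End Walk.

Lemma kostka_walks (al : 'I_l -> nat) :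
  kostka sh al = #|[set B : {ffun 'I_l -> {set 'I_n}} |
     dominant_walk B && walk_content B al && [forall i, walk_rows B l i == nth 0 la i]]|.
Proof.
apply: (card_inverse_on (f := walk_of) (g := tableau_of)).
- move=> T; rewrite !inE => /andP[/semistandardP[hr hc] /forallP cont].
  rewrite walk_of_dominant //=; apply/andP; split; apply/forallP => i.
    by rewrite card_walk_of.
  by rewrite walk_of_shape.
- move=> B; rewrite !inE => /andP[/andP[domB /forallP cont] /forallP shp].
  have B_shape i : walk_rows B l i = nth 0 la i by exact/eqP.
  have sst := tableau_of_semistandard B_shape domB.
  rewrite sst /=; apply/forallP => q; have /semistandardP[hr hc] := sst.
  by rewrite -card_walk_of // walk_of_tableau_of.
- move=> T; rewrite inE => /andP[/semistandardP[hr hc] _].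
  exact: tableau_of_walk_of.
- move=> B; rewrite inE => /andP[_ /forallP shp].
  by apply: walk_of_tableau_of => i; exact/eqP.
Qed.

End Tableaux.

(** Divided by the Vandermonde determinant, this is the expansion of a product of
  elementary symmetric polynomials into Schur polynomials: the walks are sorted
  by the partition at which they end, and those that end at [la] are tableaux. *)
Lemma prod_elsym_kostka (R : realType) (n N l : nat) (al : 'I_l -> nat) (c : 'I_n -> R) :
    (0 < l)%N ->
  (\prod_p elsym N (al p) c) * alternant N c (shifted_rows R (fun=> 0%N))
    = \sum_(la : boxpart n l) (kostka (conj_part la) al)%:R
        * alternant N c (shifted_rows R (fun i => nth 0%N la i)).
Proof.
move=> l_gt0; rewrite prod_elsym_walks.
under [RHS]eq_bigr => la _.
  rewrite kostka_walks // -sum1dep_card natr_sum mulr_suml big_mkcondr; over.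
rewrite [RHS]exchange_big; apply: eq_bigr => B /andP[/forallP domB _] /=.
pose b i := if insub i is Some i' then walk_rows B l i' else 0%N.
have [|i iN|la laE] := @boxpart_exists n l b.
- move=> i iN; rewrite /b !insubT //= ?(ltnW iN) // => iN'.
  exact: (antitone_le (i := Ordinal iN') (j := Ordinal iN) (domB ord_max)).
- by rewrite /b insubT //=; exact: walk_rows_le.
have {}laE (i : 'I_n) : nth 0%N la i = walk_rows B l i by rewrite laE // /b valK.
rewrite (bigD1 la) //= big1 ?addr0 => [|mu mula]; last first.
  case: ifP => // /forallP h; case/eqP: mula; apply: boxpart_eq => i.
  by rewrite laE (eqP (h i)).
have -> : [forall i, walk_rows B l i == nth 0%N la i] by apply/forallP => i; rewrite laE.
by rewrite mul1r; apply: eq_alternant => // i; rewrite /shifted_rows laE.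
Qed.

(** * Paths of weights *)

(** A product of transfer matrices [M i] with a common eigenvector [v], written as
  a sum over paths that end at [mu]. *)
Lemma path_expansion (T : finType) (C : comNzRingType) l (M : 'I_l -> T -> T -> C)
    (e : 'I_l -> C) (v : T -> C) (mu : T) :
    (forall i x, e i * v x = \sum_y M i x y * v y) ->
  (\prod_i e i) * v mu
    = \sum_(S : {ffun 'I_l.+1 -> T} | S ord_max == mu)
        (\prod_(i < l) M i (S (inord i.+1)) (S (inord i))) * v (S ord0).
Proof.
elim: l M e mu => [|l IH] M e mu eM.
  have max0 : ord_max = ord0 :> 'I_1 by apply: val_inj.
  rewrite big_ord0 (bigD1 [ffun=> mu]) /=; last by rewrite ffunE.
  rewrite big_ord0 ffunE big1 ?addr0 // => S /andP[/eqP Smu /eqP []].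
  apply/ffunP => i; rewrite ffunE -Smu max0; congr (S _).
  by apply: val_inj; case: i => -[].
rewrite big_ord_recr /= -mulrA eM mulr_sumr.
under [LHS]eq_bigr => y _.
  rewrite mulrCA (IH (fun i => M (widen_ord (leqnSn l) i))) ?mulr_sumr //; over.
rewrite big_ffun_rcons /= (exchange_big_dep xpredT) //=; apply: eq_bigr => S _.
rewrite (big_pred1 (S ord_max)) => [|y]; last by rewrite eq_sym.
rewrite (big_pred1 mu) => [|t]; last by rewrite ffun_rcons_max.
have low (i : nat) : (i <= l)%N -> ffun_rcons S mu (inord i) = S (inord i).
  by move=> il; apply: ffun_rcons_val; rewrite !inordK // ltnS // leqW.
have -> : ffun_rcons S mu ord0 = S ord0 by exact: ffun_rcons_val.
rewrite mulrA; congr (_ * _); rewrite big_ord_recr /= mulrC; congr (_ * _).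
  by apply: eq_bigr => i _; rewrite !low // ltnW.
have -> : inord l.+1 = ord_max :> 'I_l.+2 by apply: val_inj; rewrite /= inordK.
have l_max : inord l = ord_max :> 'I_l.+1 by apply: val_inj; rewrite /= inordK.
by rewrite ffun_rcons_max low // l_max.
Qed.

Section BoxWeights.
Variables (n k : nat).
Hypothesis n_gt1 : (1 < n)%N.

Let n_gt0 : (0 < n)%N. Proof. exact: ltnW. Qed.

Lemma nth_boxpart_last (la : boxpart n.-1 k) : nth 0%N la n.-1 = 0%N.
Proof. by rewrite nth_default // size_boxpart. Qed.

Lemma level_hat_boxpart (la : boxpart n.-1 k) : (\sum_i hat n k la i = k)%N.
Proof.
by apply: hat_level => //;
  [exact: boxpart_sorted | exact: boxpart_le | exact: nth_boxpart_last].
Qed.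

Lemma hat_boxpart_inj (la mu : boxpart n.-1 k) : hat n k la = hat n k mu -> la = mu.
Proof.
move=> e; apply: boxpart_eq => i; have lt_in : (i < n)%N by have := ltn_ord i; lia.
have := congr1 (fun m => row_of_weight m (Ordinal lt_in)) e.
by rewrite !row_of_hat ?boxpart_sorted // !nth_boxpart_last !subn0.
Qed.

Lemma hat_boxpart_surj (p : Pplus n k) : exists la : boxpart n.-1 k, hat n k la = p.
Proof.
pose b i := if insub i is Some i' then row_of_weight p (i' : 'I_n) else 0%N.
have bE (i : 'I_n) : b i = row_of_weight p i by rewrite /b valK.
have [i i_lt|i i_lt|la laE] := @boxpart_exists n.-1 k b.
- have lt1 : (i.+1 < n)%N by lia.
  have := row_of_weight_anti p (i := Ordinal (ltnW lt1)) (j := Ordinal lt1) (leqnSn i).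
  by rewrite -!bE.
- have lt1 : (i < n)%N by lia.
  by have := row_of_weight_le p (Ordinal lt1); rewrite sum_Pplus -bE.
have rowE (i : 'I_n) : nth 0%N la i = row_of_weight p i.
  have [lt|ge] := ltnP i n.-1; first by rewrite laE.
  have i_last : (i : nat) = n.-1 by have := ltn_ord i; lia.
  by rewrite row_of_weight_last // i_last nth_boxpart_last.
exists la; apply/ffunP => i; rewrite ffunE; case: eqP => [i0|/eqP i0].
  have := row_of_weight0 p i0; rewrite sum_Pplus -rowE.
  have -> : (i : nat) = 0%N by [].
  by move=> /(congr1 (subn^~ (nth 0%N la 0))) /=; rewrite addnK => ->.
have := row_of_weight_pred n_gt1 p i0; rewrite -!rowE.
have -> : (ord_pred i : nat) = i.-1 by exact: val_ord_pred.
by move=> ->; rewrite addnK.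
Qed.

Lemma big_Pplus_boxpart (V : nmodType) (F : weight n -> V) :
  \sum_(p : Pplus n k) F p = \sum_(la : boxpart n.-1 k) F (hat n k la).
Proof.
have [f fE] := fin_all_exists (fun la => level_Pplus (level_hat_boxpart la)).
have f_inj : injective f.
  by move=> la mu e; apply: hat_boxpart_inj; rewrite -!fE e.
transitivity (\sum_(p in f @: setT) F p).
  apply: eq_bigl => p; apply/esym/imsetP; have [la laE] := hat_boxpart_surj p.
  by exists la => //; apply: weight_of_Pplus_inj; rewrite fE.
rewrite big_imset; last by move=> a b _ _; exact: f_inj.
by apply: eq_big => [la|la _]; [rewrite inE | rewrite fE].
Qed.

End BoxWeights.

Section Main.
Variables (R : realType) (n k : nat).
Hypothesis n_gt1 : (1 < n)%N.
Local Notation N := (k + n)%N.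
Local Notation coord := (shifted_coord R).

Let n_gt0 : (0 < n)%N. Proof. exact: ltnW. Qed.
Let N_gt0 : (0 < N)%N. Proof. by rewrite addn_gt0 n_gt0 orbT. Qed.

Lemma fusion_column_phi r (j : 'I_n) (m m' : weight n) : (r < n)%N ->
    (\sum_i m i = k)%N -> (\sum_i m' i = k)%N ->
  fusion R k.+1 (hat n k.+1 (nseq r 1%N)) (phi j m) (phi j m') = (nstep r m m')%:R.
Proof.
move=> rn mk mk'; rewrite -(nstep_phi r j).
by apply: fusion_column => //; rewrite phi_level (mk, mk').
Qed.

Lemma alternant_del_full_columns c l (la : boxpart n l) : \sum_i c i = 0 ->
  alternant N c (coord (hat n k (del_full_columns n la)))
    = alternant N c (shifted_rows R (fun i => nth 0%N la i)).
Proof.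
move=> c0; have ss := boxpart_sorted la.
have nthE i : (i < n)%N ->
    nth 0%N (del_full_columns n la) i = (nth 0 la i - nth 0 la n.-1)%N.
  by move=> lt; rewrite (nth_map 0%N) ?size_boxpart.
rewrite alternant_hat //; last first.
  apply/(sortedP 0%N) => i; rewrite size_map size_boxpart => lt.
  by rewrite !nthE ?(ltnW lt) //= leq_sub2r // nth_anti.
rewrite -[LHS](alternant_translate N _ (nth 0%N la n.-1)%:R c0).
apply: eq_alternant => // i.
rewrite /shifted_rows nthE // natrB; first by ring.
by apply: nth_anti => //; have := ltn_ord i; lia.
Qed.

Lemma prod_elsym_paths l (al : 'I_l -> nat) (mu : boxpart n.-1 k) (si : Pplus n k) :
  (\prod_i elsym N (al i) (coord si)) * alternant N (coord si) (coord (hat n k mu))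
    = \sum_(S : {ffun 'I_l.+1 -> boxpart n.-1 k} | S ord_max == mu)
        (\prod_(i < l) (nstep (al i) (hat n k (S (inord i.+1))) (hat n k (S (inord i))))%:R)
         * alternant N (coord si) (coord (hat n k (S ord0))).
Proof.
apply: (@path_expansion (boxpart n.-1 k) R[i] l
  (fun i x y => (nstep (al i) (hat n k x) (hat n k y))%:R)
  (fun i => elsym N (al i) (coord si)) (fun x => alternant N (coord si) (coord (hat n k x)))).
move=> i la.
rewrite -(@big_Pplus_boxpart n k n_gt1 _
  (fun m : weight n => (nstep (al i) (hat n k la) m)%:R * alternant N (coord si) (coord m))).
apply: elsym_alternant_coord => //; first exact: level_hat_boxpart.
  exact: sum_coord.
exact: coord_int_diff.
Qed.

(** Both sides are the Verlinde sum with the product of the [elsym N (al i)] in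
  place of a Schur polynomial: on the right it is expanded along paths of
  weights that start from [mu], and unitarity selects those that reach [nu]; on
  the left it is expanded into Schur polynomials. *)
Lemma sum_kostka_fusion l (al : 'I_l -> nat) (mu nu : boxpart n.-1 k) : (0 < l)%N ->
  \sum_(la : boxpart n l) (kostka (conj_part la) al)%:R
      * fusion R k (hat n k (del_full_columns n la)) (hat n k mu) (hat n k nu)
    = \sum_(S : {ffun 'I_l.+1 -> boxpart n.-1 k} | (S ord0 == nu) && (S ord_max == mu))
        \prod_(i < l) (nstep (al i) (hat n k (S (inord i.+1))) (hat n k (S (inord i))))%:R.
Proof.
move=> l_gt0.
under eq_bigr do rewrite fusionE // mulrCA.
have scale_neq0 := unitary_scale_neq0 R k n_gt1.
rewrite -mulr_sumr; apply: (mulfI scale_neq0); rewrite mulVKf //.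
under eq_bigr do rewrite mulr_sumr.
rewrite exchange_big /=.
have inner (si : Pplus n k) :
  \sum_(la : boxpart n l) (kostka (conj_part la) al)%:R
      * (alternant N (coord si) (coord (hat n k (del_full_columns n la)))
          / alternant N (coord si) (coord (vacuum n k))
        * (alternant N (coord si) (coord (hat n k mu))
          * ((alternant N (coord si) (coord (hat n k nu)))^*)%C))
  = \sum_(S : {ffun 'I_l.+1 -> boxpart n.-1 k} | S ord_max == mu)
      (\prod_(i < l) (nstep (al i) (hat n k (S (inord i.+1))) (hat n k (S (inord i))))%:R)
      * (alternant N (coord si) (coord (hat n k (S ord0)))
         * ((alternant N (coord si) (coord (hat n k nu)))^*)%C).
  have c0 := sum_coord R n_gt1 si.
  under eq_bigr do rewrite alternant_del_full_columns // !mulrA.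
  rewrite -!mulr_suml -prod_elsym_kostka // -alternant_vacuum //.
  rewrite mulfK ?alternant_vacuum_neq0 // prod_elsym_paths mulr_suml.
  by under eq_bigr do rewrite -mulrA.
under eq_bigr do rewrite inner.
rewrite exchange_big big_mkcondl mulr_sumr /=; apply: eq_bigr => S _; rewrite -mulr_sumr.
have [p pE] := level_Pplus (level_hat_boxpart n_gt1 (S ord0)).
have [q qE] := level_Pplus (level_hat_boxpart n_gt1 nu).
rewrite -pE -qE alternant_unitary //.
have -> : (p == q) = (S ord0 == nu).
  apply/eqP/eqP => [pq|e]; first by apply: hat_boxpart_inj => //; rewrite -pE -qE pq.
  by apply: weight_of_Pplus_inj; rewrite pE qE e.
by case: eqP => _; rewrite ?mul1r ?mul0r ?mulr0 // mulrC.
Qed.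

End Main.

Theorem corollary7p4 (R : realType) (n k : nat) (n_ge2 : (2 <= n)%N)
    (k_ge1 : (1 <= k)%N) :
  (forall (l : nat) (al : 'I_l -> nat) (mu nu : boxpart n.-1 k)
          (j : 'I_l -> 'I_n),
     (1 <= l <= n.-1)%N -> (l <= k)%N ->
     (forall i : 'I_l, (1 <= al i <= n.-1)%N) ->
     \sum_(S : {ffun 'I_l.+1 -> boxpart n.-1 k} |
             (S ord0 == nu) && (S ord_max == mu))
        \prod_(i < l)
          fusion R k.+1
            (hat n k.+1 (nseq (al i) 1%N))
            (phi (j i) (hat n k (S (inord i.+1))))
            (phi (j i) (hat n k (S (inord i))))
     = \sum_(la : boxpart n l)
          (kostka (conj_part la) al)%:R
          * fusion R k (hat n k (del_full_columns n la)) (hat n k mu)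
              (hat n k nu))
  /\
  (forall (r : nat) (j : 'I_n) (muh nuh : Pplus n k),
     (1 <= r <= n.-1)%N ->
     fusion R k.+1 (hat n k.+1 (nseq r 1%N)) (phi j muh) (phi j nuh)
     = fusion R k (hat n k (nseq r 1%N)) muh nuh).
Proof.
have lt_n r : (1 <= r <= n.-1)%N -> (r < n)%N by lia.
split=> [l al mu nu j /andP[l_gt0 _] _ al_n|r j muh nuh /lt_n rn].
  rewrite sum_kostka_fusion //; apply: eq_bigr => S _; apply: eq_bigr => i _.
  by apply: fusion_column_phi => //; [exact: lt_n | exact: level_hat_boxpart..].
by rewrite fusion_column_phi ?sum_Pplus // fusion_column ?sum_Pplus.
Qed.
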